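(* For any strict inner Kan complex $X$ (in dendroidal sets), the canonical map $X\to N_d(\tau_d(X))$ is an isomorphism of dendroidal sets.
   Context: Operad means symmetric coloured operad in sets. Trees are finite rooted trees with a root (output) edge and a set of leaves (input edges); vertices may have any number $\ge 0$ of inputs. $\eta$ is the tree with one edge and no vertices. An edge is inner if it has a vertex at both ends; otherwise it is outer. Each tree $T$ defines an operad $\Omega(T)$ whose colours are the edges of $T$ and which is freely generated by the vertices of $T$; thus $\Omega(T)(e_1,\dots,e_n;e_0)$ is a singleton if there is a subtree of $T$ with root $e_0$ and leaves exactly the pairwise distinct edges $e_1,\dots,e_n$, and is empty otherwise. The category $\Omega$ has trees as objects and operad maps $\Omega(T)\to\Omega(T')$ as arrows. A dendroidal set is a functor $X:\Omega^{op}\to Set$, with $X_T=X(T)$; $dSet$ is the category of dendroidal sets and $\Omega[T]$ the representable one. Faces of $T$: for an inner edge $e$, the inner face $\partial_e:T/e\to T$ obtained by contracting $e$; for a vertex $v$ with exactly one inner edge attached, the outer face $\partial_v:T/v\to T$ obtained by deleting $v$ and all outer edges attached to it; if $T$ has exactly one vertex, each edge of $T$ gives an outer face $\eta\to T$. For an inner edge $e$, the inner horn $\Lambda^e[T]\subseteq\Omega[T]$ is the union of all faces except $\partial_e$. A dendroidal set $K$ is a strict inner Kan complex if for every tree $T$ and inner edge $e$ of $T$ the map $Hom(\Omega[T],K)\to Hom(\Lambda^e[T],K)$ is bijective. The dendroidal nerve functor from operads to dendroidal sets is $N_d(\mathcal P)_T=Hom(\Omega(T),\mathcal P)$; $\tau_d:dSet\to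 Operad$ is its left adjoint, and the canonical map is the unit of this adjunction. *)

(* Defs.v *)
From mathcomp Require Import all_boot all_order all_fingroup.
From mathcomp Require Import boolp.

Set Implicit Arguments.
Unset Strict Implicit.
Unset Printing Implicit Defensive.

Definition profile (C : Type) : Type := {n : nat & 'I_n -> C}.

(* Concatenation of n words of lengths k 0, ..., k (n - 1); tagnat.sig is the
   lexicographic bijection from 'I_(\sum_i k i) to {i & 'I_(k i)}. *)
Definition concat (C : Type) n (k : 'I_n -> nat) (b : forall i, 'I_(k i) -> C) :
  'I_(\sum_i k i) -> C :=
  fun p => b (tagnat.sig1 p) (tagnat.sig2 p).

Lemma sum_perm_eq n (k : 'I_n -> nat) (s : 'S_n) :
  \sum_i k i = \sum_i k (s i).
Proof. exact: (reindex_inj (@perm_inj _ s)). Qed.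

Lemma Rank_inj n (k : 'I_n -> nat) i (j : 'I_(k i)) i' (j' : 'I_(k i')) :
  tagnat.Rank i j = tagnat.Rank i' j' -> Tagged (fun i => 'I_(k i)) j = Tagged _ j'.
Proof. exact: tagnat.rank_inj. Qed.

Lemma sig_eq n (k : 'I_n -> nat) (p p' : 'I_(\sum_i k i)) :
  Tagged (fun i => 'I_(k i)) (tagnat.sig2 p) = Tagged _ (tagnat.sig2 p') ->
  p = p'.
Proof. by move=> h; apply: tagnat.sig_inj; rewrite !tagnat.sigE12. Qed.

Definition block_perm_fun n (k : 'I_n -> nat) (s : 'S_n)
    (p : 'I_(\sum_i k i)) : 'I_(\sum_i k i) :=
  let q : 'I_(\sum_i k (s i)) := cast_ord (sum_perm_eq k s) p in
  @tagnat.Rank n k (s (tagnat.sig1 q)) (tagnat.sig2 q).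

Lemma block_perm_inj n (k : 'I_n -> nat) (s : 'S_n) :
  injective (@block_perm_fun n k s).
Proof.
move=> p p' /Rank_inj h; apply: (@cast_ord_inj _ _ (sum_perm_eq k s)).
apply: sig_eq; move: (cast_ord _ p) (cast_ord _ p') h => q q'.
move: (tagnat.sig1 q) (tagnat.sig2 q) (tagnat.sig1 q') (tagnat.sig2 q').
move=> i j i' j' h.
have e : i = i' by apply: (@perm_inj _ s); case: h.
by case: i' / e j' h => j' /eqP; rewrite eq_Tagged /= => /eqP ->.
Qed.

(* The permutation of the concatenation of the words k (s 0), ...,
   k (s (n - 1)) induced by the permutation s of the blocks. *)
Definition block_perm n (k : 'I_n -> nat) (s : 'S_n) : 'S_(\sum_i k i) :=
  perm (@block_perm_inj n k s).

Definition sum_perm_fun n (k : 'I_n -> nat) (t : forall i, 'S_(k i))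
    (p : 'I_(\sum_i k i)) : 'I_(\sum_i k i) :=
  tagnat.Rank (tagnat.sig1 p) (t (tagnat.sig1 p) (tagnat.sig2 p)).

Lemma sum_perm_inj n (k : 'I_n -> nat) (t : forall i, 'S_(k i)) :
  injective (sum_perm_fun t).
Proof.
move=> p p' /Rank_inj h; apply: sig_eq.
move: (tagnat.sig1 p) (tagnat.sig2 p) (tagnat.sig1 p') (tagnat.sig2 p') h.
move=> i j i' j' h.
have e : i = i' by case: h.
by case: i' / e j' h => j' /eqP; rewrite eq_Tagged /= => /eqP /perm_inj ->.
Qed.

(* The juxtaposition of the permutations t i of the words of length k i. *)
Definition sum_perm n (k : 'I_n -> nat) (t : forall i, 'S_(k i)) :
  'S_(\sum_i k i) := perm (@sum_perm_inj n k t).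

Section Words.
Variable C : Type.

Definition word n (c : 'I_n -> C) : seq C := [seq c i | i <- enum 'I_n].

Lemma profile_eq n (c : 'I_n -> C) m (c' : 'I_m -> C) :
  word c = word c' -> existT _ n c = existT _ m c' :> profile C.
Proof.
move=> h; have e : n = m.
  by have := congr1 size h; rewrite /word 2!size_map !size_enum_ord.
case: m / e c' h => c' /eq_in_map h; congr existT; apply: funext => i.
by apply: h; rewrite mem_enum.
Qed.

Lemma profile_eq_cast n (c : 'I_n -> C) m (c' : 'I_m -> C) (e : n = m) :
  (forall i, c i = c' (cast_ord e i)) ->
  existT _ n c = existT _ m c' :> profile C.
Proof.
case: m / e c' => c' h; congr existT; apply: funext => i; rewrite h.
by congr c'; apply: val_inj.
Qed.

Lemma concat_Rank n (k : 'I_n -> nat) (b : forall i, 'I_(k i) -> C) i j :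
  concat b (tagnat.Rank i j) = b i j.
Proof.
by rewrite /concat /tagnat.sig2 /tagnat.sig1 /tagnat.Rank tagnat.rankK.
Qed.

End Words.

Lemma flatten_iota (K : nat -> nat) n :
  flatten [seq iota (\sum_(0 <= i' < i) K i') (K i) | i <- iota 0 n] =
  iota 0 (\sum_(0 <= i < n) K i).
Proof.
elim: n => [|n IH]; first by rewrite big_nil.
rewrite -addn1 iotaD map_cat flatten_cat IH /= cats0 add0n addn1.
by rewrite big_nat_recr //= iotaD.
Qed.

Lemma enum_concat n (k : 'I_n -> nat) :
  enum 'I_(\sum_i k i) =
  flatten [seq [seq tagnat.Rank i j | j <- enum 'I_(k i)] | i <- enum 'I_n].
Proof.
apply: (inj_map val_inj); rewrite val_enum_ord map_flatten -map_comp.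
pose K i := if insub i is Some i' then k i' else 0.
have KE (i : 'I_n) : K i = k i.
  by rewrite /K insubT //= => h; congr k; apply: val_inj.
transitivity (iota 0 (\sum_(0 <= i < n) K i)).
  by rewrite big_mkord; congr iota; apply: eq_bigr => i _; rewrite KE.
rewrite -flatten_iota -val_enum_ord -map_comp; congr flatten.
apply: eq_map => i /=; rewrite -map_comp KE.
rewrite -[in LHS](addn0 (\sum_(_ <= _ < _) _)) iotaDl -val_enum_ord -map_comp.
apply: eq_map => j; apply: etrans (esym (@tagnat.RankEsum n k i j)) => /=.
congr (_ + _).
rewrite (big_nat_widen 0 i n) ?(ltnW (ltn_ord i)) //= big_mkord.
by apply: eq_bigr => i' _; rewrite KE.
Qed.

Lemma word_concat C n (k : 'I_n -> nat) (b : forall i, 'I_(k i) -> C) :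
  word (concat b) = flatten [seq word (b i) | i <- enum 'I_n].
Proof.
rewrite /word enum_concat map_flatten -map_comp; congr flatten.
apply: eq_map => i /=; rewrite -map_comp; apply: eq_map => j /=.
exact: concat_Rank.
Qed.

Lemma profile_idl C n (c : 'I_n -> C) :
  existT _ _ (concat (fun _ : 'I_1 => c)) = existT _ n c :> profile C.
Proof. by apply: profile_eq; rewrite word_concat enum_ordSl enum_ord0 /= cats0. Qed.

Lemma profile_idr C n (c : 'I_n -> C) :
  existT _ _ (concat (fun i (_ : 'I_1) => c i)) = existT _ n c :> profile C.
Proof.
apply: profile_eq; rewrite word_concat /word enum_ordSl enum_ord0 /=.
by elim: (enum _) => //= i s ->.
Qed.

Lemma profile_concatA C n (k : 'I_n -> nat) (l : forall i, 'I_(k i) -> nat)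
    (a : forall i j, 'I_(l i j) -> C) :
  existT _ _ (concat (fun p => a (tagnat.sig1 p) (tagnat.sig2 p))) =
  existT _ _ (concat (fun i => concat (a i))) :> profile C.
Proof.
apply: profile_eq; rewrite !word_concat.
have -> : [seq word (a (tagnat.sig1 p) (tagnat.sig2 p)) |
    p <- enum 'I_(\sum_i k i)] = word (concat (fun i j => word (a i j))) by [].
rewrite word_concat.
under [in RHS]eq_map => i do rewrite word_concat.
by elim: (enum 'I_n) => //= i s <-; rewrite flatten_cat.
Qed.

Lemma profile_block_perm C n (k : 'I_n -> nat) (b : forall i, 'I_(k i) -> C)
    (s : 'S_n) :
  existT _ _ (concat (fun i => b (s i))) =
  existT _ _ (fun p => concat b (block_perm k s p)) :> profile C.
Proof.
apply/esym; apply: (profile_eq_cast (e := sum_perm_eq k s)) => p.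
by rewrite permE /block_perm_fun concat_Rank.
Qed.

Lemma profile_sum_perm C n (k : 'I_n -> nat) (b : forall i, 'I_(k i) -> C)
    (t : forall i, 'S_(k i)) :
  existT _ _ (concat (fun i j => b i (t i j))) =
  existT _ _ (fun p => concat b (sum_perm t p)) :> profile C.
Proof.
by congr existT; apply: funext => p; rewrite permE concat_Rank.
Qed.

(* Equality of two operations whose lists of input colours are equal, but not
   necessarily convertible (such as the two sides of associativity). *)
Definition opeq (C : Type) (op : forall n, ('I_n -> C) -> C -> Type) (d : C)
    n (c : 'I_n -> C) (f : op n c d) m (c' : 'I_m -> C) (f' : op m c' d) : Prop :=
  existT (fun p : profile C => op (tag p) (tagged p) d) (existT _ n c) f =
  existT (fun p : profile C => op (tag p) (tagged p) d) (existT _ m c') f'.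

Lemma opeq_profile (C : Type) (op : forall n, ('I_n -> C) -> C -> Type) (d : C)
    (Q : forall n (c : 'I_n -> C) (f : op n c d) m (c' : 'I_m -> C), op m c' d -> Prop) :
  (forall n (c : 'I_n -> C) (f f' : op n c d), Q n c f n c f' -> f = f') ->
  forall n (c : 'I_n -> C) (f : op n c d) m (c' : 'I_m -> C) (f' : op m c' d),
  existT _ n c = existT _ m c' :> profile C -> Q n c f m c' f' -> opeq f f'.
Proof.
move=> QE n c f m c' f'; rewrite /opeq.
have gen (p p' : profile C) (g : op (tag p) (tagged p) d)
    (g' : op (tag p') (tagged p') d) : p = p' ->
    Q _ _ g _ _ g' ->
    existT (fun p : profile C => op (tag p) (tagged p) d) p g = existT _ p' g'.
  by case: p g => n0 c0 g e; case: p' / e g' => g' /= /QE ->.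
exact: (gen (existT _ n c) (existT _ m c') f f').
Qed.

(* [op c d] is the set of operations with inputs c 0, ..., c (n - 1) and
   output d. *)
Record operad := Operad {
  col : Type;
  op : forall n, ('I_n -> col) -> col -> Type;
  oid : forall c : col, op (fun _ : 'I_1 => c) c;
  ocomp : forall n (c : 'I_n -> col) (d : col)
      (k : 'I_n -> nat) (b : forall i, 'I_(k i) -> col),
    op c d -> (forall i, op (b i) (c i)) -> op (concat b) d;
  oact : forall n (c : 'I_n -> col) (d : col) (s : 'S_n),
    op c d -> op (fun i => c (s i)) d;
  ocomp_idl : forall n (c : 'I_n -> col) (d : col) (f : op c d),
    opeq (ocomp (oid d) (fun _ => f)) f;
  ocomp_idr : forall n (c : 'I_n -> col) (d : col) (f : op c d),
    opeq (ocomp f (fun i => oid (c i))) f;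
  ocompA : forall n (c : 'I_n -> col) (d : col)
      (k : 'I_n -> nat) (b : forall i, 'I_(k i) -> col)
      (l : forall i, 'I_(k i) -> nat) (a : forall i j, 'I_(l i j) -> col)
      (f : op c d) (g : forall i, op (b i) (c i))
      (h : forall i j, op (a i j) (b i j)),
    opeq (ocomp (ocomp f g) (fun p => h (tagnat.sig1 p) (tagnat.sig2 p)))
         (ocomp f (fun i => ocomp (g i) (h i)));
  oact1 : forall n (c : 'I_n -> col) (d : col) (f : op c d),
    opeq (oact 1 f) f;
  oactM : forall n (c : 'I_n -> col) (d : col) (s t : 'S_n) (f : op c d),
    opeq (oact t (oact s f)) (oact (t * s) f);
  ocomp_actl : forall n (c : 'I_n -> col) (d : col)
      (k : 'I_n -> nat) (b : forall i, 'I_(k i) -> col) (s : 'S_n)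
      (f : op c d) (g : forall i, op (b i) (c i)),
    opeq (ocomp (oact s f) (fun i => g (s i)))
         (oact (block_perm k s) (ocomp f g));
  ocomp_actr : forall n (c : 'I_n -> col) (d : col)
      (k : 'I_n -> nat) (b : forall i, 'I_(k i) -> col)
      (t : forall i, 'S_(k i))
      (f : op c d) (g : forall i, op (b i) (c i)),
    opeq (ocomp f (fun i => oact (t i) (g i)))
         (oact (sum_perm t) (ocomp f g))
}.

Record operad_map (P Q : operad) := OperadMap {
  mcol : col P -> col Q;
  mop : forall n (c : 'I_n -> col P) (d : col P),
    op c d -> op (fun i => mcol (c i)) (mcol d);
  mop_id : forall c : col P, mop (oid c) = oid (mcol c);
  mop_comp : forall n (c : 'I_n -> col P) (d : col P)
      (k : 'I_n -> nat) (b : forall i, 'I_(k i) -> col P)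
      (f : op c d) (g : forall i, op (b i) (c i)),
    mop (ocomp f g) = ocomp (mop f) (fun i => mop (g i));
  mop_act : forall n (c : 'I_n -> col P) (d : col P) (s : 'S_n) (f : op c d),
    mop (oact s f) = oact s (mop f)
}.

Definition op_cast (P : operad) n (c c' : 'I_n -> col P) (d d' : col P)
    (ec : c = c') (ed : d = d') : op c d -> op c' d' :=
  match ec in _ = c'0, ed in _ = d'0 return op c d -> op c'0 d'0 with
  | erefl, erefl => id
  end.

Lemma op_cast_id (P : operad) n (c : 'I_n -> col P) (d : col P)
    (ec : c = c) (ed : d = d) (f : op c d) : op_cast ec ed f = f.
Proof.
by rewrite (Prop_irrelevance ec erefl) (Prop_irrelevance ed erefl).
Qed.

Lemma operad_map_ext (P Q : operad) (f g : operad_map P Q) :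
  mcol f =1 mcol g ->
  (forall n (c : 'I_n -> col P) (d : col P) (o : op c d) ec ed,
     op_cast ec ed (mop f o) = mop g o) ->
  f = g.
Proof.
case: f g => [fc fo f1 f2 f3] [gc go g1 g2 g3] /= /funext e.
case: gc / e go g1 g2 g3 => go g1 g2 g3 h.
have e : fo = go.
  apply: functional_extensionality_dep => n.
  apply: functional_extensionality_dep => c.
  apply: functional_extensionality_dep => d.
  by apply: funext => o; rewrite -(h _ _ _ o erefl erefl).
case: go / e g1 g2 g3 h => g1 g2 g3 _.
by rewrite (Prop_irrelevance f1 g1) (Prop_irrelevance f2 g2)
  (Prop_irrelevance f3 g3).
Qed.

Definition operad_map_id (P : operad) : operad_map P P.
Proof. by exists id (fun n c d => id). Defined.

Definition operad_map_comp (P Q R : operad)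
    (g : operad_map Q R) (f : operad_map P Q) : operad_map P R.
Proof.
exists (fun c => mcol g (mcol f c)) (fun n c d o => mop g (mop f o)).
- by move=> c; rewrite !mop_id.
- by move=> n c d k b o o'; rewrite !mop_comp.
- by move=> n c d s o; rewrite !mop_act.
Defined.

Lemma operad_map_comp1l (P Q : operad) (f : operad_map P Q) :
  operad_map_comp (operad_map_id Q) f = f.
Proof. by apply: operad_map_ext => //= *; rewrite op_cast_id. Qed.

Lemma operad_map_comp1r (P Q : operad) (f : operad_map P Q) :
  operad_map_comp f (operad_map_id P) = f.
Proof. by apply: operad_map_ext => //= *; rewrite op_cast_id. Qed.

Lemma operad_map_compA (P Q R S : operad) (h : operad_map R S)
    (g : operad_map Q R) (f : operad_map P Q) :
  operad_map_comp h (operad_map_comp g f) =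
  operad_map_comp (operad_map_comp h g) f.
Proof. by apply: operad_map_ext => //= *; rewrite op_cast_id. Qed.

Definition descend (E V : finType) (out : V -> E) (par : E -> option V) (e : E) :=
  if par e is Some v then out v else e.

(* [out v] is the output edge of the vertex v, and [par e] is the vertex of
   which e is an input, which exists if and only if e is not the root edge.
   [descend] goes one step towards the root. *)
Record tree := Tree {
  edge : finType;
  vert : finType;
  root : edge;
  out : vert -> edge;
  par : edge -> option vert;
  out_inj : injective out;
  par_root : forall e, (par e == None) = (e == root);
  tree_conn : forall e, fconnect (descend out par) e root
}.

Section TreeTheory.
Variable T : tree.
Implicit Types (e a b x : edge T) (v w : vert T).

Definition inner e : bool := (par e != None) && [exists v, out v == e].

Definition attached e v : bool := (out v == e) || (par e == Some v).

(* W is the vertex set of a subtree with root r: every vertex of W other than the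
   one above r sits on top of an input edge of a vertex of W. The empty W is the
   subtree consisting of the edge r alone. *)
Definition is_subtree (W : {set vert T}) (r : edge T) : bool :=
  [forall w in W,
     (out w == r) || [exists w' in W, par (out w) == Some w']].

Definition subtree_edges (W : {set vert T}) (r : edge T) : {set edge T} :=
  r |: [set e | [exists w in W, par e == Some w]].

Definition subtree_leaves (W : {set vert T}) (r : edge T) : {set edge T} :=
  subtree_edges W r :\: [set out w | w in W].

(* Omega(T)(c 0, ..., c (n - 1); r) has at most one element, so that it is
   represented by the proposition that it is inhabited. *)
Definition Omega_op n (c : 'I_n -> edge T) (r : edge T) : bool :=
  injectiveb c &&
  [exists W : {set vert T},
     is_subtree W r && (subtree_leaves W r == [set c i | i : 'I_n])].

Definition down e := descend (@out T) (@par T) e.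

(* [below a b]: the edge a lies on the path from b to the root. *)
Definition below a b : bool := fconnect down b a.

Lemma below_refl a : below a a. Proof. exact: connect0. Qed.

Lemma below_trans b a x : below a b -> below b x -> below a x.
Proof. by move=> ab bx; apply: connect_trans bx ab. Qed.

Lemma below_root a : below (root T) a. Proof. exact: tree_conn. Qed.

Lemma belowP a b : reflect (exists k, iter k down b = a) (below a b).
Proof.
apply: (iffP idP) => [/iter_findex h|[k <-]]; last exact: fconnect_iter.
by exists (findex down b a).
Qed.

Lemma below_down a : below (down a) a. Proof. exact: fconnect1. Qed.

Lemma par_rootN : par (root T) = None.
Proof. by apply/eqP; rewrite par_root. Qed.

Lemma downE a v : par a = Some v -> down a = out v.
Proof. by rewrite /down /descend => ->. Qed.

Lemma down_root : down (root T) = root T.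
Proof. by rewrite /down /descend par_rootN. Qed.

Lemma down_id a : down a = a -> a = root T.
Proof.
move=> h; have /belowP[k] := below_root a.
by elim: k => //= k IH; rewrite -iterS iterSr h.
Qed.

Lemma down_neq a v : par a = Some v -> down a != a.
Proof.
move=> h; apply/eqP => /down_id e; move: h; by rewrite e par_rootN.
Qed.

Lemma below_step a b : below a b -> a != b -> below a (down b).
Proof.
move=> /belowP[[|k] <-] /=; first by rewrite eqxx.
by move=> _; apply/belowP; exists k; rewrite -iterSr.
Qed.

Lemma below_anti a b : below a b -> below b a -> a = b.
Proof.
move=> /belowP[k hk] /belowP[l hl].
have cyc x m : 0 < m -> iter m down x = x -> x = root T.
  move=> m0 hm; have /belowP[p hp] := below_root x.
  have hq q : iter (q * m) down x = x.
    by elim: q => // q IH; rewrite mulSn iterD IH.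
  have e : p * m = p * m - p + p by rewrite subnK // leq_pmulr.
  rewrite -(hq p) e iterD hp; elim: (p * m - p) => //= q ->.
  exact: down_root.
case: k hk => [//|k] hk.
have ea : a = root T by apply: (cyc _ (k.+1 + l)) => //; rewrite iterD hl.
have eb : b = root T.
  by apply: (cyc _ (l + k.+1)); [rewrite addnS | rewrite iterD hk].
by rewrite ea eb.
Qed.

Lemma below_total a b x : below a x -> below b x -> below a b || below b a.
Proof.
move=> /belowP[k <-] /belowP[l <-].
case: (leqP k l) => [kl|/ltnW kl]; apply/orP; [right|left]; apply/belowP.
  by exists (l - k); rewrite -iterD subnK.
by exists (k - l); rewrite -iterD subnK.
Qed.

Lemma par_out_inj a v w : par a = Some v -> out v = out w -> par a = Some w.
Proof. by move=> ha /out_inj <-. Qed.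

(* A criterion for L to be the set of leaves of a subtree with root r; see
   [subtree_cut] and [cut_subtree]. *)
Definition is_cut (L : edge T -> Prop) (r : edge T) : Prop :=
  [/\ forall l, L l -> below r l,
      forall l l', L l -> L l' -> below l l' -> l = l' &
      forall x, below r x ->
        (exists2 l, L l & below l x) \/ exists v, out v = x].

Lemma subtree_vert_below (W : {set vert T}) r w :
  is_subtree W r -> w \in W -> below r (out w).
Proof.
move=> /forall_inP sW; have /belowP[k] := below_root (out w).
elim: k w => [|k IH] w /= hk wW; have /orP[/eqP->|] := sW _ wW.
- exact: below_refl.
- by case/exists_inP => w' _; rewrite hk par_rootN.
- exact: below_refl.
case/exists_inP => w' w'W /eqP h; move: hk; rewrite -iterS iterSr (downE h).
move/IH => /(_ w'W) h'; apply: below_trans h' _.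
by rewrite -(downE h) below_down.
Qed.

Lemma subtree_vert_closed (W : {set vert T}) r w a :
  is_subtree W r -> w \in W -> below r a -> below a (out w) ->
  a \in [set out w | w in W].
Proof.
move=> sW wW ra /belowP[k]; elim: k w wW => [|k IH] w wW.
  by move=> /= <-; apply: imset_f.
rewrite iterSr; move/forall_inP: (sW) => /(_ _ wW) /orP[/eqP e|].
  move=> h; have ar : below a r.
    by apply/belowP; exists k.+1; rewrite iterSr -e.
  by rewrite (below_anti ar ra) -e imset_f.
by case/exists_inP => w' w'W /eqP h; rewrite (downE h); apply: IH.
Qed.

Lemma subtree_cut (W : {set vert T}) r :
  is_subtree W r -> is_cut (fun l => l \in subtree_leaves W r) r.
Proof.
move=> sW; have edge_below l : l \in subtree_edges W r -> below r l.
  rewrite !inE => /orP[/eqP->|]; first exact: below_refl.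
  case/exists_inP => w wW /eqP h; apply: below_trans (below_down l).
  by rewrite (downE h); apply: subtree_vert_below wW.
split=> [l|l l'|x].
- by rewrite inE => /andP[_ /edge_below].
- rewrite !inE => /andP[lW lE] /andP[l'W l'E] ll'.
  have rl : below r l by apply: edge_below; rewrite !inE.
  case: (eqVneq l l') => // nl; case/orP: l'E => [/eqP e|].
    by apply: below_anti => //; rewrite e.
  case/exists_inP => w wW /eqP h; case/negP: lW.
  apply: (subtree_vert_closed sW wW rl).
  by rewrite -(downE h); apply: below_step.
move=> rx; suff: (exists2 l, l \in subtree_leaves W r & below l x) \/
    (x \in [set out w | w in W]).
  case=> [|/imsetP[w _ ->]]; first by left.
  by right; exists w.
have hE y : y \in subtree_edges W r ->
    (exists2 l, l \in subtree_leaves W r & below l y) \/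
    (y \in [set out w | w in W]).
  move=> yE; case yW: (y \in [set out w | w in W]); first by right.
  by left; exists y; rewrite ?below_refl // inE yW.
move/belowP: rx => [k]; elim: k x => [|k IH] x.
  by move=> /= ->; apply: hE; rewrite !inE eqxx.
rewrite iterSr => /IH[[l lL lx]|].
  by left; exists l => //; apply: below_trans lx (below_down x).
case/imsetP => w wW; case h: (par x) => [v|]; last first.
  by rewrite /down /descend h => ->; right; apply: imset_f.
rewrite (downE h) => e; apply: hE; rewrite !inE; apply/orP; right.
by apply/exists_inP; exists w => //; rewrite (par_out_inj h e).
Qed.

Lemma cut_subtree (L : {set edge T}) r :
  is_cut (fun l => l \in L) r ->
  exists2 W : {set vert T}, is_subtree W r & subtree_leaves W r = L.
Proof.
case=> [h1 h2 h3].
pose W := [set w | below r (out w) && [forall l in L, ~~ below l (out w)]].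
exists W.
  apply/forall_inP => w; rewrite inE => /andP[rw /forall_inP Lw].
  case: (eqVneq (out w) r) => //= nr.
  case h: (par (out w)) => [w'|]; last first.
    move/eqP: h; rewrite par_root => /eqP e.
    by case/eqP: nr; apply: below_anti => //; rewrite e below_root.
  apply/exists_inP; exists w' => //; rewrite inE -(downE h).
  rewrite below_step 1?eq_sym //=; apply/forall_inP => l lL.
  apply: contra (Lw _ lL) => hl; exact: below_trans hl (below_down _).
apply/setP => e; rewrite !inE; apply/andP/idP => [[eW eE]|eL].
  have re : below r e.
    case/orP: eE => [/eqP->|]; first exact: below_refl.
    case/exists_inP => w; rewrite inE => /andP[rw _] /eqP h.
    by apply: below_trans (below_down e); rewrite (downE h).
  case: (boolP [exists l in L, below l e]) => [|nl].
    case/exists_inP => l lL le; case: (eqVneq l e) => [<- //|nle].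
    case/orP: eE => [/eqP ee|].
      by case/eqP: nle; apply: below_anti; rewrite // ee h1.
    case/exists_inP => w; rewrite inE => /andP[_ /forall_inP Lw] /eqP h.
    by case/negP: (Lw _ lL); rewrite -(downE h) below_step.
  case: (h3 _ re) => [[l lL le]|[v ev]].
    by case/exists_inP: nl; exists l.
  case/negP: eW; rewrite -ev; apply: imset_f; rewrite inE ev re.
  by apply/forall_inP => l lL; apply: contra nl => hl; apply/exists_inP; exists l.
split.
  apply/imsetP => -[w]; rewrite inE => /andP[_ /forall_inP Lw] ee.
  by case/negP: (Lw _ eL); rewrite ee below_refl.
case: (eqVneq e r) => //= ner; case h: (par e) => [w|]; last first.
  move/eqP: h; rewrite par_root => /eqP ee.
  by case/eqP: ner; apply: below_anti; [rewrite ee below_root | apply: h1].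
apply/exists_inP; exists w => //; rewrite inE -(downE h).
rewrite below_step ?h1 1?eq_sym //=; apply/forall_inP => l lL; apply/negP => hl.
have le := below_trans hl (below_down e).
have el : l = e by apply: h2.
case/eqP: (down_neq h); apply: below_anti; rewrite ?below_down //.
by rewrite -{1}el.
Qed.

Lemma Omega_opP n (c : 'I_n -> edge T) r :
  reflect [/\ forall i, below r (c i),
              forall i j, below (c i) (c j) -> i = j &
              forall x, below r x ->
                (exists i, below (c i) x) \/ exists v, out v = x]
          (Omega_op c r).
Proof.
apply: (iffP andP) => [[/injectiveP ci /existsP[W /andP[sW /eqP eL]]]|].
  have := subtree_cut sW; rewrite eL => -[h1 h2 h3]; split.
  - by move=> i; apply: h1; apply: imset_f.
  - by move=> i j ij; apply: ci; apply: h2 ij; apply: imset_f.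
  move=> x /h3[[l /imsetP[i _ ->] lx]|]; last by right.
  by left; exists i.
case=> [h1 h2 h3]; split.
  by apply/injectiveP => i j ij; apply: h2; rewrite ij below_refl.
have [|W sW eL] := @cut_subtree [set c i | i : 'I_n] r.
  split.
  - by move=> l /imsetP[i _ ->].
  - by move=> l l' /imsetP[i _ ->] /imsetP[j _ ->] /h2 ->.
  move=> x /h3[[i ix]|]; last by right.
  by left; exists (c i) => //; apply: imset_f.
by apply/existsP; exists W; rewrite sW eL /=.
Qed.

Lemma Omega_id e : Omega_op (fun _ : 'I_1 => e) e.
Proof.
apply/Omega_opP; split=> [i|i j _|x ex]; first exact: below_refl.
  by rewrite !ord1.
by left; exists ord0.
Qed.

Lemma Omega_comp n (c : 'I_n -> edge T) d (k : 'I_n -> nat)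
    (b : forall i, 'I_(k i) -> edge T) :
  Omega_op c d -> (forall i, Omega_op (b i) (c i)) -> Omega_op (concat b) d.
Proof.
move=> /Omega_opP[h1 h2 h3] g; apply/Omega_opP; rewrite /concat.
have {}g i := elimT (Omega_opP (b i) (c i)) (g i).
split=> [p|p p'|x dx].
- by apply: below_trans (h1 _) _; case: (g (tagnat.sig1 p)).
- move=> pp'; apply: sig_eq.
  move: (tagnat.sig1 p) (tagnat.sig2 p) (tagnat.sig1 p') (tagnat.sig2 p') pp'.
  move=> i j i' j' jj'.
  have [gi _ _] := g i; have [gi' _ _] := g i'.
  have ij' := below_trans (gi j) jj'.
  have e : i = i' by case/orP: (below_total ij' (gi' j')) => /h2.
  case: i' / e j' jj' {gi' ij'} => j' jj'; have [_ g2 _] := g i.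
  by rewrite (g2 _ _ jj').
case: (h3 _ dx) => [[i ix]|]; last by right.
have [_ _ /(_ _ ix)[[j jx]|]] := g i; last by right.
left; exists (tagnat.Rank i j).
by have := concat_Rank b j; rewrite /concat => ->.
Qed.

Lemma Omega_act n (c : 'I_n -> edge T) d (s : 'S_n) :
  Omega_op c d -> Omega_op (fun i => c (s i)) d.
Proof.
move=> /Omega_opP[h1 h2 h3]; apply/Omega_opP; split=> [//|i j /h2/perm_inj //|].
move=> x /h3[[i ix]|]; last by right.
by left; exists (s^-1 i)%g; rewrite permKV.
Qed.

End TreeTheory.

Section TreeOperad.
Variable T : tree.

Let top n (c : 'I_n -> edge T) (d : edge T) : Type := Omega_op c d.

Let top_opeq d n (c : 'I_n -> edge T) (f : top c d) m (c' : 'I_m -> edge T)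
    (f' : top c' d) :
  existT _ n c = existT _ m c' :> profile (edge T) -> opeq f f'.
Proof.
move=> e; apply: (opeq_profile (Q := fun _ _ _ _ _ _ => True)) => //.
by move=> n0 c0 f0 f0' _; apply: bool_irrelevance.
Qed.

Definition Omega : operad.
Proof.
refine (@Operad (edge T) top (@Omega_id T)
  (fun n c d k b f g => Omega_comp f g) (fun n c d s f => Omega_act s f)
  _ _ _ _ _ _ _) => *; apply: top_opeq.
- exact: profile_idl.
- exact: profile_idr.
- exact: profile_concatA.
- by congr existT; apply: funext => i; rewrite perm1.
- by congr existT; apply: funext => i; rewrite permM.
- exact: profile_block_perm.
- exact: profile_sum_perm.
Defined.

End TreeOperad.

Definition tree_map (S T : tree) : Type := operad_map (Omega S) (Omega T).

Lemma tree_map_ext (S T : tree) (f g : tree_map S T) :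
  mcol f =1 mcol g -> f = g.
Proof.
move=> h; apply: operad_map_ext => // n c d o ec ed; exact: bool_irrelevance.
Qed.

Section MkTreeMap.
Variables (S T : tree) (f : edge S -> edge T).
Hypothesis fP : forall n (c : 'I_n -> edge S) (d : edge S),
  Omega_op c d -> Omega_op (fun i => f (c i)) (f d).

Definition mk_tree_map : tree_map S T.
Proof.
by exists (f : col (Omega S) -> col (Omega T)) (fun n c d o => fP o) => *;
  apply: bool_irrelevance.
Defined.

End MkTreeMap.

Definition eta : tree.
Proof.
by refine (@Tree unit void tt (of_void unit) (fun _ => None) _ _ _) => [[]||[]].
Defined.

Lemma edge_map_proof (T : tree) (e : edge T) n (c : 'I_n -> edge eta)
    (d : edge eta) :
  Omega_op c d -> Omega_op (fun _ : 'I_n => e) e.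
Proof.
move=> /Omega_opP[_ h2 h3]; apply/Omega_opP; split=> [i|i j _|x ex].
- exact: below_refl.
- by apply: h2; case: (c i) (c j) => -[]; apply: below_refl.
by case: (h3 d (below_refl d)) => [[i _]|[[]]]; left; exists i.
Qed.

Definition edge_map (T : tree) (e : edge T) : tree_map eta T :=
  mk_tree_map (fun n c d => @edge_map_proof T e n c d).

Section InnerFace.
Variables (T : tree) (e : edge T).
Hypothesis he : inner e.

Let E := {x : edge T | x != e}.
Let V := {w : vert T | out w != e}.

Lemma contract_root_proof : root T != e.
Proof. by case/andP: he => h _; rewrite eq_sym -par_root. Qed.

Definition contract_root : E := exist _ (root T) contract_root_proof.

Definition contract_out (w : V) : E := exist _ (out (val w)) (valP w).

(* The vertex at the top of e is merged with the one at its bottom. *)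
Definition contract_par (x : E) : option V :=
  let keep (w : vert T) : option V := insub w in
  if par (val x) is Some w
  then if out w == e then obind keep (par e) else keep w
  else None.

Let top : {v | out v = e}.
Proof. by case/andP: he => _ /existsP h; exists (xchoose h); apply/eqP/(xchooseP h). Qed.

Let bot : {v | par e = Some v & out v != e}.
Proof.
case/andP: he => + _; case h: (par e) => [v|] // _; exists v => //.
by rewrite -(downE h) (down_neq h).
Qed.

Lemma contract_down (x : E) :
  val (descend contract_out contract_par x) =
  if down (val x) == e then down e else down (val x).
Proof.
case: bot => v pe nv.
rewrite {1}/descend /contract_par; case h: (par (val x)) => [w|]; last first.
  by rewrite /down /descend h (negPf (valP x)).
rewrite (downE h); case: eqP => [ew|/eqP ew].
  by rewrite pe /= insubT /= (downE pe).
by rewrite insubT.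
Qed.

Lemma contract_below (x y : E) :
  fconnect (descend contract_out contract_par) y x = below (val x) (val y).
Proof.
apply/idP/idP.
  move=> /iter_findex <-; move: (findex _ _ _) => k.
  elim: k => [|k IH] /=; first exact: below_refl.
  apply: below_trans IH; rewrite contract_down.
  case: eqP => [h|_]; last exact: below_down.
  have := below_down (val (iter k (descend contract_out contract_par) y)).
  by rewrite h; apply: below_trans (below_down _).
move=> /belowP[k]; elim/ltn_ind: k x y => k IH x y.
case: k IH => [_ /= /val_inj -> //|k IH]; rewrite iterSr.
have := contract_down y; set y' := descend _ _ _; case: eqP => [-> hy'|_ hy'].
  case: k IH => [|k] IH; first by move=> /= ex; case/eqP: (valP x).
  rewrite iterSr -hy' => /IH h; apply: connect_trans (h _) => //.
  exact: fconnect1.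
rewrite -hy' => /IH h; apply: connect_trans (h _) => //; exact: fconnect1.
Qed.

Lemma contract_out_inj : injective contract_out.
Proof. by move=> w w' /(congr1 val) /= /out_inj /val_inj. Qed.

Lemma contract_par_root x : (contract_par x == None) = (x == contract_root).
Proof.
rewrite -val_eqE /= -par_root /contract_par.
case h: (par (val x)) => [w|] //; case: bot => v -> nv /=.
by case: (boolP (out w == e)) => ew; rewrite insubT.
Qed.

Lemma contract_conn x :
  fconnect (descend contract_out contract_par) x contract_root.
Proof. by rewrite contract_below /= below_root. Qed.

Definition contract : tree :=
  Tree contract_out_inj contract_par_root contract_conn.

Lemma inner_face_proof n (c : 'I_n -> edge contract) (d : edge contract) :
  Omega_op c d -> Omega_op (fun i => val (c i)) (val d).
Proof.
have bE (x y : edge contract) : below x y = below (val x) (val y).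
  exact: contract_below.
move=> /Omega_opP[h1 h2 h3]; apply/Omega_opP; split=> [i|i j|x dx].
- by rewrite -bE.
- by rewrite -bE => /h2.
case: (eqVneq x e) => [->|nx].
  by case: top => v ev; right; exists v.
have [|[i ix]|[v ev]] := h3 (exist _ x nx : edge contract).
- by rewrite bE.
- by left; exists i; rewrite bE in ix.
by right; exists (val v); have := congr1 val ev.
Qed.

Definition inner_face : tree_map contract T := mk_tree_map inner_face_proof.

End InnerFace.

Definition outer_vertex (T : tree) (v : vert T) : bool :=
  #|[set x : edge T | attached x v && inner x]| == 1.

Section OuterFace.
Variables (T : tree) (v : vert T).
Hypothesis hv : outer_vertex v.

Definition kept (x : edge T) : bool := ~~ (attached x v && ~~ inner x).
Let E := {x : edge T | kept x}.
Let V := {w : vert T | w != v}.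

Let exists_inner : exists x, attached x v && inner x.
Proof.
have /card_gt0P[x] : 0 < #|[set x : edge T | attached x v && inner x]|.
  by rewrite (eqP hv).
by rewrite inE; exists x.
Qed.

Let b : edge T := xchoose exists_inner.

Let bP : attached b v && inner b. Proof. exact: (xchooseP exists_inner). Qed.

Let b_uniq x : attached x v -> inner x -> x = b.
Proof.
move=> xv xi; case/cards1P: hv => y /setP hy.
have := hy x; have := hy b; rewrite !inE bP xv xi.
by move=> /esym/eqP -> /esym/eqP.
Qed.

Let b_kept : kept b. Proof. by case/andP: bP => _ h; rewrite /kept h andbF. Qed.

Lemma prune_root_proof : kept (if kept (root T) then root T else b).
Proof. by case: ifP. Qed.

Definition prune_root : E := exist (fun x => kept x) _ prune_root_proof.

Lemma prune_out_proof (w : V) : kept (out (val w)).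
Proof.
rewrite /kept negb_and negbK; case: (boolP (attached _ v)) => //=.
rewrite /attached => /orP[/eqP/out_inj e|/eqP h].
  by case/eqP: (valP w).
by rewrite /inner h /=; apply/existsP; exists (val w).
Qed.

Definition prune_out (w : V) : E :=
  exist (fun x => kept x) (out (val w)) (prune_out_proof w).

Definition prune_par (x : E) : option V :=
  obind (fun w : vert T => insub w : option V) (par (val x)).

Let inner_out (w : vert T) x : par x <> None -> out w = x -> inner x.
Proof.
by move=> /eqP h ew; rewrite /inner h /=; apply/existsP; exists w; rewrite ew.
Qed.

Let root_case x : kept x -> par x = Some v ->
  [/\ x = b, out v = root T & ~~ kept (root T)].
Proof.
move=> kx px; have ax : attached x v by rewrite /attached px eqxx orbT.
have ix : inner x by move: kx; rewrite /kept ax /= negbK.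
have xb := b_uniq ax ix.
have av : attached (out v) v by rewrite /attached eqxx.
have er : out v = root T.
  apply/eqP; rewrite -par_root; apply: contraT => /eqP h.
  have := b_uniq av (inner_out h erefl); rewrite -xb => e.
  by have := down_neq px; rewrite (downE px) e eqxx.
by split=> //; rewrite /kept negbK -er av /= /inner er par_rootN.
Qed.

Lemma prune_down (x : E) :
  val (descend prune_out prune_par x) =
  if par (val x) == Some v then val x else down (val x).
Proof.
rewrite {1}/descend /prune_par /down /descend.
case h: (par (val x)) => [w|] //=; case: (eqVneq w v) => [->|wv].
  by rewrite insubF ?eqxx.
by rewrite insubT /= (inj_eq Some_inj) (negPf wv).
Qed.

Lemma prune_below (x y : E) :
  fconnect (descend prune_out prune_par) y x = below (val x) (val y).
Proof.
apply/idP/idP.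
  move=> /iter_findex <-; move: (findex _ _ _) => k.
  elim: k => [|k IH] /=; first exact: below_refl.
  apply: below_trans IH; rewrite prune_down.
  by case: ifP => _; [apply: below_refl | apply: below_down].
move=> /belowP[k]; elim: k y => [|k IH] y.
  by move=> /= /val_inj ->; apply: connect0.
rewrite iterSr; have := prune_down y; set y' := descend _ _ _.
case: eqP => [h _|_ <- /IH h]; last first.
  by apply: connect_trans h; apply: fconnect1.
have [_ er nk] := root_case (valP y) h.
rewrite (downE h) er => e; case/negP: nk.
have -> : root T = val x; last exact: (valP x).
by rewrite -e; elim: (k) => //= q <-; rewrite down_root.
Qed.

Lemma prune_out_inj : injective prune_out.
Proof. by move=> w w' /(congr1 val) /= /out_inj /val_inj. Qed.

Lemma prune_par_root x : (prune_par x == None) = (x == prune_root).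
Proof.
rewrite -val_eqE [val prune_root]/= /prune_par.
case h: (par (val x)) => [w|]; rewrite [obind _ _]/=; last first.
  have /eqP e : val x == root T by rewrite -par_root h.
  have kx : kept (val x) := valP x.
  by rewrite e in kx *; rewrite kx eqxx.
have nr : val x != root T by rewrite -par_root h.
case: (eqVneq w v) => [ew|wv].
  have [|xb _ nk] := root_case (valP x); first by rewrite h ew.
  by rewrite ew insubF ?eqxx // (negPf nk) xb eqxx.
rewrite insubT [LHS]/=; apply/esym/negP => /eqP.
case: ifP => [_ e|nk e]; first by rewrite e eqxx in nr.
have er : out v = root T.
  move/negbT: nk; rewrite /kept negbK => /andP[+ _].
  by rewrite /attached par_rootN orbF => /eqP.
case/andP: bP => + _; rewrite -e /attached h er (eq_sym (root T)) (negPf nr) /=.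
by rewrite (inj_eq Some_inj) (negPf wv).
Qed.

Lemma prune_conn x : fconnect (descend prune_out prune_par) x prune_root.
Proof.
rewrite prune_below [val prune_root]/=; case: ifP => [_|nk]; first exact: below_root.
have kx : kept (val x) := valP x.
have er : out v = root T.
  move/negbT: nk; rewrite /kept negbK => /andP[+ _].
  by rewrite /attached par_rootN orbF => /eqP.
have /belowP[k] := below_root (val x).
have : inner (val x) || ~~ attached (val x) v.
  by move: kx; rewrite /kept negb_and negbK orbC.
elim: k (val x) {kx} => [|k IH] y.
  move=> + e; move: nk; rewrite /= in e; rewrite e /kept => /negbT.
  by rewrite negbK => /andP[-> /negPf ->].
move=> hy; rewrite iterSr => e.
case h: (par y) => [w|]; last first.
  apply: (IH y) => //; move: e; rewrite /down /descend h //.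
case: (eqVneq w v) => [ew|wv].
  have ay : attached y v by rewrite /attached h ew eqxx orbT.
  by rewrite ay orbF in hy; rewrite (b_uniq ay hy) below_refl.
apply: below_trans (below_down y); apply: IH => //; rewrite (downE h).
rewrite /attached (inj_eq (@out_inj T)) (eq_sym v) (negPf wv) /=.
case: eqP => [pw|_]; last by rewrite orbT.
by rewrite (@inner_out w) // pw.
Qed.

(* Outer edges attached to v are deleted, and so is v. If v is the root vertex,
   the inner edge attached to v becomes the root. *)
Definition prune : tree := Tree prune_out_inj prune_par_root prune_conn.

Lemma outer_face_proof n (c : 'I_n -> edge prune) (d : edge prune) :
  Omega_op c d -> Omega_op (fun i => val (c i)) (val d).
Proof.
have bE (x y : edge prune) : below x y = below (val x) (val y).
  exact: prune_below.
move=> /Omega_opP[h1 h2 h3]; apply/Omega_opP; split=> [i|i j|x dx].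
- by rewrite -bE.
- by rewrite -bE => /h2.
have keptP y (ky : kept y) : below (val d) y ->
    (exists i, below (val (c i)) y) \/ exists v, out v = y.
  move=> dy; have [|[i iy]|[w ew]] := h3 (exist _ y ky : edge prune).
  - by rewrite bE.
  - by left; exists i; rewrite bE in iy.
  by right; exists (val w); have := congr1 val ew.
case: (boolP (kept x)) => [/keptP/(_ dx) //|].
have kd : kept (val d) := valP d.
rewrite /kept negbK => /andP[/orP[/eqP|/eqP] hx ix]; first by right; exists v.
have nxd : val d != x.
  apply: contraL kd => /eqP ->.
  by rewrite /kept negbK ix andbT /attached hx eqxx orbT.
have dv : below (val d) (out v) by rewrite -(downE hx) below_step.
case: (boolP (kept (out v))) => [ko|].
  have vx : below (out v) x by rewrite -(downE hx) below_down.
  have [|[i iv]|[w ew]] := h3 (exist _ (out v) ko : edge prune).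
  - by rewrite bE.
  - left; exists i; rewrite bE in iv.
    exact: below_trans iv vx.
  by have /out_inj e := congr1 val ew; have := valP w; rewrite e eqxx.
rewrite /kept negbK => /andP[av ni]; move/eqP: nxd; case.
have er : out v = root T.
  by apply/eqP; rewrite -par_root; apply: contraR ni => /eqP h; apply: inner_out h _.
have ed : val d = root T.
  by apply: below_anti; rewrite ?below_root // -er.
by move: kd; rewrite ed -er /kept av ni.
Qed.

Definition outer_face : tree_map prune T := mk_tree_map outer_face_proof.

End OuterFace.

Inductive face (T : tree) : Type :=
| FaceInner (e : edge T) of inner e
| FaceOuter (v : vert T) of outer_vertex v
| FaceEdge (e : edge T) of #|vert T| == 1.

Definition face_tree (T : tree) (phi : face T) : tree :=
  match phi with
  | FaceInner _ he => contract he
  | FaceOuter _ hv => prune hv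
  | FaceEdge _ _ => eta
  end.

Definition face_map (T : tree) (phi : face T) : tree_map (face_tree phi) T :=
  match phi with
  | FaceInner _ he => inner_face he
  | FaceOuter _ hv => outer_face hv
  | FaceEdge e _ => edge_map e
  end.

Record dset := DSet {
  dobj :> tree -> Type;
  dres : forall S T : tree, tree_map S T -> dobj T -> dobj S;
  dres_id : forall (T : tree) (x : dobj T),
    dres (operad_map_id (Omega T)) x = x;
  dres_comp : forall (R S T : tree) (f : tree_map S T) (g : tree_map R S)
      (x : dobj T),
    dres (operad_map_comp f g) x = dres g (dres f x)
}.

Record dmor (X Y : dset) := DMor {
  dfun :> forall T : tree, X T -> Y T;
  dnat : forall (S T : tree) (f : tree_map S T) (x : X T),
    dfun (dres f x) = dres f (dfun x)
}.

Lemma dmor_ext (X Y : dset) (f g : dmor X Y) :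
  (forall T (x : X T), f T x = g T x) -> f = g.
Proof.
case: f g => [f fn] [g gn] /= h.
have e : f = g.
  by apply: functional_extensionality_dep => T; apply: funext => x; apply: h.
by case: g / e gn {h} => gn; rewrite (Prop_irrelevance fn gn).
Qed.

Definition dmor_id (X : dset) : dmor X X :=
  @DMor X X (fun T x => x) (fun S T f x => erefl).

Definition dmor_comp (X Y Z : dset) (g : dmor Y Z) (f : dmor X Y) : dmor X Z.
Proof. by exists (fun T x => g T (f T x)) => S T p x; rewrite !dnat. Defined.

Definition dset_iso (X Y : dset) (f : dmor X Y) : Prop :=
  exists g : dmor Y X, dmor_comp g f = dmor_id X /\ dmor_comp f g = dmor_id Y.

Definition representable (T : tree) : dset.
Proof.
exists (fun S => tree_map S T) (fun R S f g => operad_map_comp g f).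
- by move=> S g; apply: operad_map_comp1r.
- by move=> Q R S f g h; apply: operad_map_compA.
Defined.

Section Horn.
Variables (T : tree) (e : edge T) (he : inner e).

(* The arrows S -> T factoring through some face other than that of e. *)
Definition in_horn (S : tree) (f : tree_map S T) : Prop :=
  exists2 phi : face T, phi <> FaceInner he &
    exists g : tree_map S (face_tree phi), f = operad_map_comp (face_map phi) g.

Lemma in_horn_res (R S : tree) (g : tree_map R S) (f : tree_map S T) :
  in_horn f -> in_horn (operad_map_comp f g).
Proof.
case=> phi hphi [h ->]; exists phi => //; exists (operad_map_comp h g).
by rewrite operad_map_compA.
Qed.

Definition horn : dset.
Proof.
exists (fun S => {f : tree_map S T | in_horn f})
  (fun R S g f => exist _ (operad_map_comp (sval f) g)
                          (in_horn_res g (svalP f))).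
- by move=> S [f hf]; apply: eq_exist; apply: operad_map_comp1r.
- by move=> Q R S f g [h hh]; apply: eq_exist; apply: operad_map_compA.
Defined.

Definition horn_incl : dmor horn (representable T).
Proof. by exists (fun S f => sval f). Defined.

End Horn.

Definition strict_inner_kan (K : dset) : Prop :=
  forall (T : tree) (e : edge T) (he : inner e),
    bijective (fun f : dmor (representable T) K => dmor_comp f (horn_incl he)).

Definition nerve (P : operad) : dset.
Proof.
exists (fun T => operad_map (Omega T) P) (fun S T f g => operad_map_comp g f).
- by move=> T g; apply: operad_map_comp1r.
- by move=> R S T f g h; apply: operad_map_compA.
Defined.

Definition nerve_map (P Q : operad) (g : operad_map P Q) :
  dmor (nerve P) (nerve Q).
Proof.
by exists (fun T f => operad_map_comp g f) => S T f x; apply: operad_map_compA.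
Defined.

Section Tau.
Variable X : dset.

Definition edge_col (T : tree) (x : X T) (e : edge T) : X eta :=
  dres (edge_map e) x.

(* The operad tau_d X is presented by generators and relations: the colours are
   the elements of X eta, and there is one generator for each operation of
   Omega T and each x in X T, subject to the relations which make
   x |-> (Omega T -> tau_d X) well defined and natural in T. *)
Inductive term : forall n, ('I_n -> X eta) -> X eta -> Type :=
| TGen (T : tree) (x : X T) n (c : 'I_n -> edge T) (d : edge T)
    (w : op (o := Omega T) c d) (c' : 'I_n -> X eta) (d' : X eta) :
    (fun i => edge_col x (c i)) = c' -> edge_col x d = d' -> term c' d'
| TId (c : X eta) : term (fun _ : 'I_1 => c) c
| TComp n (c : 'I_n -> X eta) (d : X eta)
    (k : 'I_n -> nat) (b : forall i, 'I_(k i) -> X eta) :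
    term c d -> (forall i, term (b i) (c i)) -> term (concat b) d
| TAct n (c : 'I_n -> X eta) (d : X eta) (s : 'S_n) :
    term c d -> term (fun i => c (s i)) d.

Inductive term_rel : forall (d : X eta) n (c : 'I_n -> X eta) (t : term c d)
    m (c' : 'I_m -> X eta) (t' : term c' d), Prop :=
| TRrefl d n (c : 'I_n -> X eta) (t : term c d) : term_rel t t
| TRsym d n (c : 'I_n -> X eta) (t : term c d)
    m (c' : 'I_m -> X eta) (t' : term c' d) :
    term_rel t t' -> term_rel t' t
| TRtrans d n (c : 'I_n -> X eta) (t : term c d)
    m (c' : 'I_m -> X eta) (t' : term c' d)
    l (c'' : 'I_l -> X eta) (t'' : term c'' d) :
    term_rel t t' -> term_rel t' t'' -> term_rel t t''
| TRcomp n (c : 'I_n -> X eta) (d : X eta)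
    (k : 'I_n -> nat) (b : forall i, 'I_(k i) -> X eta)
    (t t' : term c d) (u u' : forall i, term (b i) (c i)) :
    term_rel t t' -> (forall i, term_rel (u i) (u' i)) ->
    term_rel (TComp t u) (TComp t' u')
| TRact n (c : 'I_n -> X eta) (d : X eta) (s : 'S_n) (t t' : term c d) :
    term_rel t t' -> term_rel (TAct s t) (TAct s t')
| TRidl n (c : 'I_n -> X eta) (d : X eta) (t : term c d) :
    term_rel (TComp (TId d) (fun _ => t)) t
| TRidr n (c : 'I_n -> X eta) (d : X eta) (t : term c d) :
    term_rel (TComp t (fun i => TId (c i))) t
| TRcompA n (c : 'I_n -> X eta) (d : X eta)
    (k : 'I_n -> nat) (b : forall i, 'I_(k i) -> X eta)
    (l : forall i, 'I_(k i) -> nat) (a : forall i j, 'I_(l i j) -> X eta)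
    (t : term c d) (u : forall i, term (b i) (c i))
    (v : forall i j, term (a i j) (b i j)) :
    term_rel (TComp (TComp t u) (fun p => v (tagnat.sig1 p) (tagnat.sig2 p)))
             (TComp t (fun i => TComp (u i) (v i)))
| TRact1 n (c : 'I_n -> X eta) (d : X eta) (t : term c d) :
    term_rel (TAct 1 t) t
| TRactM n (c : 'I_n -> X eta) (d : X eta) (r s : 'S_n) (t : term c d) :
    term_rel (TAct s (TAct r t)) (TAct (s * r) t)
| TRcomp_actl n (c : 'I_n -> X eta) (d : X eta)
    (k : 'I_n -> nat) (b : forall i, 'I_(k i) -> X eta) (s : 'S_n)
    (t : term c d) (u : forall i, term (b i) (c i)) :
    term_rel (TComp (TAct s t) (fun i => u (s i)))
             (TAct (block_perm k s) (TComp t u))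
| TRcomp_actr n (c : 'I_n -> X eta) (d : X eta)
    (k : 'I_n -> nat) (b : forall i, 'I_(k i) -> X eta)
    (s : forall i, 'S_(k i))
    (t : term c d) (u : forall i, term (b i) (c i)) :
    term_rel (TComp t (fun i => TAct (s i) (u i)))
             (TAct (sum_perm s) (TComp t u))
| TRgen_id (T : tree) (x : X T) (e : edge T) :
    term_rel (TGen (x := x) (oid (o := Omega T) e) erefl erefl)
             (TId (edge_col x e))
| TRgen_comp (T : tree) (x : X T) n (c : 'I_n -> edge T) (d : edge T)
    (k : 'I_n -> nat) (b : forall i, 'I_(k i) -> edge T)
    (w : op (o := Omega T) c d) (w' : forall i, op (o := Omega T) (b i) (c i)) :
    term_rel (TGen (x := x) (ocomp w w') erefl erefl)
             (TComp (TGen (x := x) w erefl erefl)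
                    (fun i => TGen (x := x) (w' i) erefl erefl))
| TRgen_act (T : tree) (x : X T) n (c : 'I_n -> edge T) (d : edge T)
    (s : 'S_n) (w : op (o := Omega T) c d) :
    term_rel (TGen (x := x) (oact s w) erefl erefl)
             (TAct s (TGen (x := x) w erefl erefl))
| TRgen_nat (S T : tree) (f : tree_map S T) (x : X T)
    n (c : 'I_n -> edge S) (d : edge S) (w : op (o := Omega S) c d)
    (c' : 'I_n -> X eta) (d' : X eta) ec ed ec' ed' :
    term_rel (@TGen S (dres f x) n c d w c' d' ec ed)
             (@TGen T x n _ _ (mop f w) c' d' ec' ed').

Lemma term_rel_profile d n (c : 'I_n -> X eta) (t : term c d)
    m (c' : 'I_m -> X eta) (t' : term c' d) :
  term_rel t t' -> existT _ n c = existT _ m c' :> profile (X eta).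
Proof.
elim=> //.
- by move=> > _ -> _ ->.
- by move=> *; apply: profile_idl.
- by move=> *; apply: profile_idr.
- by move=> *; apply: profile_concatA.
- by move=> *; congr existT; apply: funext => i; rewrite perm1.
- by move=> *; congr existT; apply: funext => i; rewrite permM.
- by move=> *; apply: profile_block_perm.
- by move=> *; apply: profile_sum_perm.
Qed.

Definition tau_op n (c : 'I_n -> X eta) (d : X eta) : Type :=
  {S : term c d -> Prop | exists t : term c d, S = fun t' => term_rel t t'}.

Definition cls n (c : 'I_n -> X eta) (d : X eta) (t : term c d) : tau_op c d :=
  exist _ (fun t' => term_rel t t') (ex_intro _ t erefl).

Definition rep n (c : 'I_n -> X eta) (d : X eta) (f : tau_op c d) : term c d :=
  sval (cid (svalP f)).

Lemma repK n (c : 'I_n -> X eta) (d : X eta) (f : tau_op c d) :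
  cls (rep f) = f.
Proof.
rewrite /rep; case: cid => t /= ht; case: f ht => S hS /= ht.
exact: eq_exist.
Qed.

Lemma cls_rel n (c : 'I_n -> X eta) (d : X eta) (t t' : term c d) :
  term_rel t t' -> cls t = cls t'.
Proof.
move=> h; apply: eq_exist; apply: funext => u; apply/propext; split.
  by apply: TRtrans; apply: TRsym.
exact: TRtrans.
Qed.

Lemma rep_cls n (c : 'I_n -> X eta) (d : X eta) (t : term c d) :
  term_rel (rep (cls t)) t.
Proof.
have := congr1 sval (repK (cls t)) => /= /(congr1 (fun S => S t)) ->.
exact: TRrefl.
Qed.

Lemma cls_opeq d n (c : 'I_n -> X eta) (t : term c d)
    m (c' : 'I_m -> X eta) (t' : term c' d) :
  term_rel t t' -> opeq (cls t) (cls t').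
Proof.
move=> h; pose Q n (c : 'I_n -> X eta) (f : tau_op c d) m (c' : 'I_m -> X eta)
    (f' : tau_op c' d) := exists t t', [/\ f = cls t, f' = cls t' & term_rel t t'].
apply: (opeq_profile (Q := Q)); last by exists t, t'.
  by move=> n0 c0 f f' [u [u' [-> -> /cls_rel]]].
exact: term_rel_profile h.
Qed.

Definition tau_comp n (c : 'I_n -> X eta) (d : X eta)
    (k : 'I_n -> nat) (b : forall i, 'I_(k i) -> X eta)
    (f : tau_op c d) (g : forall i, tau_op (b i) (c i)) : tau_op (concat b) d :=
  cls (TComp (rep f) (fun i => rep (g i))).

Definition tau_act n (c : 'I_n -> X eta) (d : X eta) (s : 'S_n)
    (f : tau_op c d) : tau_op (fun i => c (s i)) d :=
  cls (TAct s (rep f)).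

Lemma tau_compE n (c : 'I_n -> X eta) (d : X eta)
    (k : 'I_n -> nat) (b : forall i, 'I_(k i) -> X eta)
    (t : term c d) (u : forall i, term (b i) (c i)) :
  tau_comp (cls t) (fun i => cls (u i)) = cls (TComp t u).
Proof. by apply: cls_rel; apply: TRcomp => *; apply: rep_cls. Qed.

Lemma tau_actE n (c : 'I_n -> X eta) (d : X eta) (s : 'S_n) (t : term c d) :
  tau_act s (cls t) = cls (TAct s t).
Proof. by apply: cls_rel; apply: TRact; apply: rep_cls. Qed.

Lemma cls_ind n (c : 'I_n -> X eta) (d : X eta) (Q : tau_op c d -> Prop) :
  (forall t, Q (cls t)) -> forall f, Q f.
Proof. by move=> h f; rewrite -(repK f). Qed.

Lemma cls_ind_fam (I : Type) n (c : forall i : I, 'I_(n i) -> X eta)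
    (d : I -> X eta) (Q : (forall i, tau_op (c i) (d i)) -> Prop) :
  (forall t : forall i, term (c i) (d i), Q (fun i => cls (t i))) ->
  forall f, Q f.
Proof.
move=> h f; suff -> : f = fun i => cls (rep (f i)) by [].
by apply: functional_extensionality_dep => i; rewrite repK.
Qed.

Definition tau : operad.
Proof.
refine (@Operad (X eta) tau_op (fun c => cls (TId c)) tau_comp tau_act
  _ _ _ _ _ _ _).
- move=> n c d; apply: cls_ind => t.
  by rewrite (tau_compE _ (fun _ => t)); apply: cls_opeq; apply: TRidl.
- move=> n c d; apply: cls_ind => t.
  by rewrite (tau_compE _ (fun i => TId (c i))); apply: cls_opeq; apply: TRidr.
- move=> n c d k b l a; apply: cls_ind => t; apply: cls_ind_fam => u h.
  pose v i j := rep (h i j).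
  have -> : h = fun i j => cls (v i j).
    apply: functional_extensionality_dep => i.
    by apply: functional_extensionality_dep => j; rewrite repK.
  rewrite tau_compE (tau_compE _ (fun p => v (tagnat.sig1 p) (tagnat.sig2 p))).
  have -> : (fun i => tau_comp (cls (u i)) (fun j => cls (v i j))) =
      fun i => cls (TComp (u i) (v i)).
    by apply: functional_extensionality_dep => i; rewrite tau_compE.
  by rewrite tau_compE; apply: cls_opeq; apply: TRcompA.
- move=> n c d; apply: cls_ind => t.
  by rewrite tau_actE; apply: cls_opeq; apply: TRact1.
- move=> n c d r s; apply: cls_ind => t.
  by rewrite !tau_actE; apply: cls_opeq; apply: TRactM.
- move=> n c d k b s; apply: cls_ind => t; apply: cls_ind_fam => u.
  rewrite tau_actE (tau_compE _ (fun i => u (s i))) tau_compE tau_actE.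
  by apply: cls_opeq; apply: TRcomp_actl.
- move=> n c d k b s; apply: cls_ind => t; apply: cls_ind_fam => u.
  have -> : (fun i => tau_act (s i) (cls (u i))) = fun i => cls (TAct (s i) (u i)).
    by apply: functional_extensionality_dep => i; rewrite tau_actE.
  by rewrite !tau_compE tau_actE; apply: cls_opeq; apply: TRcomp_actr.
Defined.

Definition tau_unit_fun (T : tree) (x : X T) : operad_map (Omega T) tau.
Proof.
exists (edge_col x : col (Omega T) -> col tau)
  (fun n c d w => cls (TGen (x := x) w erefl erefl)).
- by move=> e; apply: cls_rel; apply: TRgen_id.
- move=> n c d k b w w'.
  rewrite [RHS](tau_compE _ (fun i => TGen (x := x) (w' i) erefl erefl)).
  by apply: cls_rel; apply: TRgen_comp.
- by move=> n c d s w; rewrite [RHS]tau_actE; apply: cls_rel; apply: TRgen_act.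
Defined.

Lemma edge_col_res (S T : tree) (f : tree_map S T) (x : X T) (e : edge S) :
  edge_col (dres f x) e = edge_col x (mcol f e).
Proof.
by rewrite /edge_col -dres_comp; congr dres; apply: tree_map_ext.
Qed.

Lemma tau_cast_gen (T : tree) (x : X T) n (c : 'I_n -> edge T) (d : edge T)
    (w : op (o := Omega T) c d) (c1 c2 : 'I_n -> X eta) (d1 d2 : X eta)
    (e1 : (fun i => edge_col x (c i)) = c1) (f1 : edge_col x d = d1)
    (e2 : (fun i => edge_col x (c i)) = c2) (f2 : edge_col x d = d2) ec ed :
  op_cast (P := tau) ec ed (cls (TGen w e1 f1)) = cls (TGen w e2 f2).
Proof.
case: c2 / ec e2; case: d2 / ed f2 => f2 e2; rewrite op_cast_id.
by rewrite (Prop_irrelevance e1 e2) (Prop_irrelevance f1 f2).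
Qed.

Lemma tau_unit_nat (S T : tree) (f : tree_map S T) (x : X T) :
  tau_unit_fun (dres f x) = operad_map_comp (tau_unit_fun x) f.
Proof.
have h e : edge_col (dres f x) e = edge_col x (mcol f e) := edge_col_res f x e.
apply: operad_map_ext => //= n c d w ec ed.
rewrite (tau_cast_gen _ erefl erefl ec ed).
by apply: cls_rel; apply: TRgen_nat.
Qed.

Definition tau_unit : dmor X (nerve tau) := @DMor X (nerve tau) _ tau_unit_nat.

End Tau.

Lemma existT_inj (I : Type) (P : I -> Type) (i : I) (x y : P i) :
  existT P i x = existT P i y -> x = y.
Proof.
move=> h; suff gen (u v : sigT P) (e : u = v) :
    eq_rect _ P (projT2 u) _ (congr1 (@projT1 I P) e) = projT2 v.
  have := gen _ _ h.
  by rewrite (Prop_irrelevance (congr1 (@projT1 I P) h) (erefl i)).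
by case: v / e.
Qed.

Lemma opeq_eq (P : operad) n (c : 'I_n -> col P) (d : col P) (f f' : op c d) :
  opeq f f' -> f = f'.
Proof. exact: existT_inj. Qed.

Section OpCast.
Variables (P : operad) (I : Type) (A B : I -> col P).
Hypothesis AB : A = B.

Lemma op_cast_oid a e1 e2 :
  op_cast (c := fun _ => A a) (c' := fun _ => B a) e1 e2 (oid (A a)) = oid (B a).
Proof. by case: B / AB e1 e2 => e1 e2; rewrite op_cast_id. Qed.

Lemma op_cast_ocomp n (c : 'I_n -> I) (d : I)
    (k : 'I_n -> nat) (b : forall i, 'I_(k i) -> I)
    (f : op (fun i => A (c i)) (A d))
    (g : forall i, op (fun j => A (b i j)) (A (c i))) e1 e2 e3 e4 e5 e6 :
  op_cast (c := fun p => A (concat b p)) (c' := fun p => B (concat b p))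
    (d' := B d) e1 e2 (ocomp f g) =
  ocomp (op_cast (c' := fun i => B (c i)) e3 e4 f)
        (fun i => op_cast (c' := fun j => B (b i j)) (e5 i) (e6 i) (g i)).
Proof.
case: B / AB e1 e2 e3 e4 e5 e6 => *; rewrite !op_cast_id; congr ocomp.
by apply: functional_extensionality_dep => i; rewrite op_cast_id.
Qed.

Lemma op_cast_oact n (c : 'I_n -> I) (d : I) (s : 'S_n)
    (f : op (fun i => A (c i)) (A d)) e1 e2 e3 e4 :
  op_cast (c := fun i => A (c (s i))) (c' := fun i => B (c (s i)))
    (d' := B d) e1 e2 (oact s f) =
  oact s (op_cast (c' := fun i => B (c i)) e3 e4 f).
Proof. by case: B / AB e1 e2 e3 e4 => *; rewrite !op_cast_id. Qed.

End OpCast.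

Lemma op_cast_mop (P Q : operad) (f g : operad_map P Q) n (c : 'I_n -> col P)
    (d : col P) (o : op c d) c' d' e1 e2 e3 e4 :
  f = g ->
  op_cast (c' := c') (d' := d') e1 e2 (mop f o) = op_cast e3 e4 (mop g o).
Proof.
move=> e; case: g / e e3 e4 => e3 e4.
by rewrite (Prop_irrelevance e1 e3) (Prop_irrelevance e2 e4).
Qed.

Lemma op_cast_trans (P : operad) n (c1 c2 c3 : 'I_n -> col P)
    (d1 d2 d3 : col P) (e1 : c1 = c2) (f1 : d1 = d2) (e2 : c2 = c3)
    (f2 : d2 = d3) (o : op c1 d1) :
  op_cast e2 f2 (op_cast e1 f1 o) = op_cast (etrans e1 e2) (etrans f1 f2) o.
Proof. by case: c3 / e2; case: d3 / f2; case: c2 / e1; case: d2 / f1. Qed.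

Section TauUniversal.
Variables (X : dset) (P : operad) (f : dmor X (nerve P)).

Let fcol (a : X eta) : col P := mcol (f eta a) (tt : edge eta).

Let fcolE (T : tree) (x : X T) (e : edge T) :
  mcol (f T x) e = fcol (edge_col x e).
Proof. by rewrite /fcol /edge_col dnat. Qed.

Let fcol_in (T : tree) (x : X T) n (c : 'I_n -> edge T) (c' : 'I_n -> X eta)
    (ec : (fun i => edge_col x (c i)) = c') :
  (fun i => mcol (f T x) (c i)) = (fun i => fcol (c' i)).
Proof. by case: c' / ec; apply: funext => i; apply: fcolE. Qed.

Let fcol_out (T : tree) (x : X T) (d : edge T) (d' : X eta)
    (ed : edge_col x d = d') : mcol (f T x) d = fcol d'.
Proof. by case: d' / ed; apply: fcolE. Qed.

Let eval : forall n (c : 'I_n -> X eta) (d : X eta),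
  term c d -> op (fun i => fcol (c i)) (fcol d) :=
  fix eval n c d t := match t in @term _ n c d
                      return op (fun i => fcol (c i)) (fcol d) with
  | TGen T x n c d w c' d' ec ed =>
      op_cast (fcol_in ec) (fcol_out ed) (mop (f T x) w)
  | TId a => oid (fcol a)
  | TComp n c d k b t u => ocomp (eval _ _ _ t) (fun i => eval _ _ _ (u i))
  | TAct n c d s t => oact s (eval _ _ _ t)
  end.

Let eval_rel d n (c : 'I_n -> X eta) (t : term c d)
    m (c' : 'I_m -> X eta) (t' : term c' d) :
  term_rel t t' -> opeq (eval t) (eval t').
Proof.
elim=> {n c d t m c' t'}.
- by [].
- by move=> *; apply/esym.
- by move=> d n c t m c' t' l c'' t'' _ h _ h'; apply: etrans h h'.
- move=> n c d k b t t' u u' _ /opeq_eq /= -> _ h.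
  suff -> : (fun i => eval (u i)) = fun i => eval (u' i) by [].
  by apply: functional_extensionality_dep => i; apply: opeq_eq.
- by move=> n c d s t t' _ /opeq_eq /= ->.
- by move=> n c d t; apply: ocomp_idl.
- by move=> n c d t; apply: ocomp_idr.
- by move=> n c d k b l a t u v; apply: ocompA (eval t) _ (fun i j => eval (v i j)).
- by move=> n c d t; apply: oact1.
- by move=> n c d r s t; apply: oactM.
- by move=> n c d k b s t u; apply: ocomp_actl (eval t) (fun i => eval (u i)).
- by move=> n c d k b s t u; apply: ocomp_actr (eval t) (fun i => eval (u i)).
- move=> T x e /=.
  have AB : mcol (f T x) = (fun e => fcol (edge_col x e)) :> (edge T -> _).
    by apply: funext => a; apply: fcolE.
  by rewrite mop_id (op_cast_oid AB).
- move=> T x n c d k b w w' /=.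
  have AB : mcol (f T x) = (fun e => fcol (edge_col x e)) :> (edge T -> _).
    by apply: funext => a; apply: fcolE.
  by rewrite mop_comp (op_cast_ocomp AB _ _ _ _ (fcol_in erefl)
    (fcol_out erefl) (fun i => fcol_in erefl) (fun i => fcol_out erefl)).
- move=> T x n c d s w /=.
  have AB : mcol (f T x) = (fun e => fcol (edge_col x e)) :> (edge T -> _).
    by apply: funext => a; apply: fcolE.
  by rewrite mop_act (op_cast_oact AB _ _ _ (fcol_in erefl) (fcol_out erefl)).
- move=> S T p x n c d w c' d' ec ed ec' ed' /=; congr existT.
  have e : f S (dres p x) = operad_map_comp (f T x) p by rewrite dnat.
  have := @op_cast_mop (Omega S) P (f S (dres p x))
    (operad_map_comp (f T x) p) n c d w (fun i => fcol (c' i)) (fcol d')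
    (fcol_in ec) (fcol_out ed) (fcol_in ec') (fcol_out ed') e.
  exact.
Qed.

Let eval_cls n (c : 'I_n -> X eta) (d : X eta) (t : term c d) :
  eval (rep (cls t)) = eval t.
Proof. by apply: opeq_eq; apply: eval_rel; apply: rep_cls. Qed.

Definition tau_lift : operad_map (tau X) P.
Proof.
exists (fcol : col (tau X) -> col P) (fun n c d o => eval (rep o)).
- by move=> c; rewrite [LHS]eval_cls.
- by move=> n c d k b o g; rewrite [LHS]eval_cls.
- by move=> n c d s o; rewrite [LHS]eval_cls.
Defined.

Lemma tau_liftK : dmor_comp (nerve_map tau_lift) (tau_unit X) = f.
Proof.
apply: dmor_ext => T x /=; apply: operad_map_ext => /= [e|n c d w ec ed].
  by rewrite fcolE.
by rewrite eval_cls /= op_cast_trans op_cast_id.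
Qed.

Lemma tau_lift_uniq (h : operad_map (tau X) P) :
  dmor_comp (nerve_map h) (tau_unit X) = f -> h = tau_lift.
Proof.
move=> hf.
have hx T (x : X T) : operad_map_comp h (tau_unit_fun x) = f T x by rewrite -hf.
have hc : mcol h = fcol.
  apply: funext => a; rewrite /fcol -hx /=; congr mcol.
  rewrite /edge_col -[LHS]dres_id; congr dres; apply: tree_map_ext => -[] //.
have hop n (c : 'I_n -> X eta) d (t : term c d) ec ed :
    op_cast (c' := fun i => fcol (c i)) (d' := fcol d) ec ed (mop h (cls t))
    = eval t.
  elim: t ec ed => {n c d} /=.
  - move=> T x n c d w c' d' e1 e2 ec ed.
    case: c' / e1 ec => ec; case: d' / e2 ed => ed.
    have := @op_cast_mop (Omega T) P (operad_map_comp h (tau_unit_fun x))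
      (f T x) n c d w (fun i => fcol (edge_col x (c i))) (fcol (edge_col x d))
      ec ed (fcol_in erefl) (fcol_out erefl) (hx T x).
    exact.
  - move=> a ec ed; have -> := mop_id h a.
    exact: (op_cast_oid hc).
  - move=> n c d k b t IHt u IHu ec ed.
    have e : ocomp (o := tau X) (cls t) (fun i => cls (u i)) = cls (TComp t u).
      exact: tau_compE.
    have -> := congr1 (fun o => mop h o) (esym e).
    have e3 : (fun i => mcol h (c i)) = fun i => fcol (c i) by rewrite hc.
    have e5 i : (fun j => mcol h (b i j)) = fun j => fcol (b i j) by rewrite hc.
    have e4 d0 : mcol h d0 = fcol d0 by rewrite hc.
    rewrite mop_comp (op_cast_ocomp hc _ _ _ _ e3 (e4 d) e5 (fun i => e4 _)).
    rewrite IHt; congr ocomp.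
    by apply: functional_extensionality_dep => i; apply: IHu.
  move=> n c d s t IHt ec ed.
  have e : oact (o := tau X) s (cls t) = cls (TAct s t) := tau_actE s t.
  have -> := congr1 (fun o => mop h o) (esym e).
  have e3 : (fun i => mcol h (c i)) = fun i => fcol (c i) by rewrite hc.
  have e4 : mcol h d = fcol d by rewrite hc.
  by rewrite mop_act (op_cast_oact hc _ _ _ e3 e4) IHt.
apply: operad_map_ext => [a|n c d o ec ed]; first by rewrite hc.
by rewrite -[in LHS](repK o) hop.
Qed.

End TauUniversal.

(* Universality of [tau_unit] for all X: this is the statement that [tau] is
   (the object part of) a left adjoint to the nerve, with unit [tau_unit]. *)
Theorem tau_universal (X : dset) (P : operad) (f : dmor X (nerve P)) :
  exists! g : operad_map (tau X) P,
    dmor_comp (nerve_map g) (tau_unit X) = f.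
Proof.
exists (tau_lift f); split; first exact: tau_liftK.
by move=> h /tau_lift_uniq.
Qed.

(* Main.v *)
From mathcomp Require Import all_boot all_order all_fingroup.
From mathcomp Require Import boolp.
Require Import Defs.

(* A strict inner Kan complex X satisfies a Segal condition: an element of X T is
   determined by its restrictions to the arrows into T which stay inside one vertex
   of T, and every compatible family of such restrictions comes from an element.
   This is proved by induction on the number of vertices of T, cutting T along an
   inner edge e which has a single layer of leaves above it. The element is obtained
   by filling the inner horn at e; the elements on the faces, given by induction,
   agree because an element of X is determined by its restrictions to corollas, and
   a corolla of T in whose interior e lies can be expanded by e.

   The Segal condition for trees of height two composes the elements of X over
   corollas. Every relation between terms of tau X is an equality of two operations
   of Omega T for a single tree T and a single element of X T, hence terms of tau X
   have well defined values in X, and tau X has the same operations as X over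
   corollas. *)

Set Implicit Arguments.
Unset Strict Implicit.
Unset Printing Implicit Defensive.

(** * Cuts of trees and maps of trees *)

(** Intersections of faces are never described. A compatible family is a relation between arrows
    into [T] and elements of [X]; once it is functional and natural, agreement on overlaps is
    automatic, and existence is checked on each face alone. The difficulty moves to functionality,
    where one arrow may factor through two faces.

    Interiority concerns the subtree spanned by an arrow, not its image: contracting an inner edge
    [e] removes it from the image and leaves it in the interior. Every other face contains [e]
    itself, so an induction over the faces in the horn can keep this edge.

    The single layer of leaves above [e] leaves two places for an arrow without [e] in its interior:
    the outer face that deletes the vertex [v] on top of [e], or the corolla of [v], which lies in
    another face of the horn. Surjectivity of the unit on larger trees extends an element from the
    same two pieces, and compares operad maps by splitting each operation at [e]. *)

Definition cut_family (T : tree) (I : Type) (c : I -> edge T) (d : edge T) : Prop :=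
  [/\ forall i, below d (c i),
      forall i j, below (c i) (c j) -> i = j &
      forall x, below d x ->
        (exists i, below (c i) x) \/ exists v, out v = x].

Definition leaf (T : tree) (x : edge T) : Prop := forall v, out v <> x.

Section CutFamilies.
Variable T : tree.
Implicit Types (a b d e x : edge T) (v : vert T).

(** Over ['I_n] a cut family is the criterion [Omega_opP] for an operation of [Omega T]. Reindexing
    lets subtypes and option types serve as sets of inputs. *)
Lemma cut_family_reindex (I J : Type) (g : I -> J) (c : J -> edge T) d :
  bijective g -> cut_family c d <-> cut_family (c \o g) d.
Proof.
case=> h hK gK; split=> -[h1 h2 h3]; split.
- by move=> i; apply: h1.
- by move=> i j /h2 e; rewrite -(hK i) e hK.
- move=> x /h3[[j jx]|]; last by right.
  by left; exists (h j); rewrite /= gK.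
- by move=> i; rewrite -(gK i); apply: h1.
- by move=> i j ij; rewrite -(gK i) -(gK j); congr g; apply: h2; rewrite /= !gK.
- move=> x /h3[[j jx]|]; last by right.
  by left; exists (g j).
Qed.

Lemma cut_family_inj (I : Type) (c : I -> edge T) d :
  cut_family c d -> injective c.
Proof. by case=> _ h _ i j e; apply: h; rewrite e below_refl. Qed.

Lemma above_leaf a x : leaf a -> below a x -> a = x.
Proof.
move=> la /belowP[k]; elim: k => [//|k IH] /=; set y := iter _ _ _.
rewrite /down /descend; case h: (par y) => [v|//] e.
by case: (la v).
Qed.

(* The antichain A is completed to a cut above r by the leaves which are not above A. *)
Lemma complete_cut (A : {set edge T}) r :
  (forall a, a \in A -> below r a) ->
  (forall a b, a \in A -> b \in A -> below a b -> a = b) ->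
  exists B : {set edge T}, [/\ A \subset B, forall x, x \in B -> x \in A \/ leaf x &
    cut_family (fun x : {x | x \in B} => val x) r].
Proof.
move=> h1 h2.
pose B := A :|: [set x | `[< leaf x >] && below r x &
                 [forall a in A, ~~ below a x]].
exists B; split; first exact: subsetUl.
  by move=> x; rewrite !inE => /orP[|/andP[/andP[/asboolP]]]; [left|right].
split=> [[x] /=|[x hx] [y hy] /= xy|x rx].
- by rewrite !inE => /orP[/h1 //|/andP[/andP[]]].
- apply: val_inj => /=; move: hx hy; rewrite !inE.
  case/orP=> [xA|/andP[/andP[/asboolP lx _] _]]; last first.
    by move=> _; apply: above_leaf.
  case/orP=> [yA|/andP[_ /forall_inP/(_ _ xA)]]; first exact: h2.
  by rewrite xy.
case: (pselect (leaf x)) => [lx|nl]; last first.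
  by right; apply: contrapT => nv; apply: nl => v ev; apply: nv; exists v.
left; case: (boolP [forall a in A, ~~ below a x]) => [hA|].
  have xB : x \in B by rewrite !inE hA rx andbT (introT (asboolP _) lx) orbT.
  by exists (exist _ x xB); apply: below_refl.
rewrite negb_forall_in => /exists_inP[a aA]; rewrite negbK => ax.
have aB : a \in B by rewrite inE aA.
by exists (exist _ a aB).
Qed.

Lemma vertex_cut v : cut_family (fun x : {x | par x == Some v} => val x) (out v).
Proof.
split=> [[x /= /eqP hx]|[x hx] [y hy] /= xy|x vx].
- by rewrite -(downE hx) below_down.
- apply: val_inj => /=; case: (eqVneq x y) => // nxy.
  have := below_step xy nxy; rewrite (downE (eqP hy)) => xv.
  have e : x = out v.
    by apply: below_anti => //; rewrite -(downE (eqP hx)) below_down.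
  by have := down_neq (eqP hx); rewrite (downE (eqP hx)) e eqxx.
suff [->|[y py yx]] : x = out v \/ exists2 y, par y = Some v & below y x.
- by right; exists v.
- by left; exists (exist _ y (introT eqP py)).
move/belowP: vx => [k]; elim: k x => [|k IH] x; first by move=> /= ->; left.
rewrite iterSr; case h : (par x) => [w|]; last first.
  have -> : down x = x by rewrite /down /descend h.
  exact: IH.
case/IH => [e|[y py yx]].
  right; exists x; last exact: below_refl.
  by rewrite h; congr Some; apply: out_inj; rewrite -(downE h).
by right; exists y => //; apply: below_trans yx (below_down _).
Qed.

End CutFamilies.

Section TreeMaps.
Variables (S T : tree) (f : tree_map S T).
Implicit Types (a b d : edge S).
Local Notation fe := (mcol f : edge S -> edge T).

(** This is the action of [f] on operations; the order-theoretic properties of tree maps below all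
    come from it. *)
Lemma tree_map_cut (I : finType) (c : I -> edge S) d :
  cut_family c d -> cut_family (fun i => fe (c i)) (fe d).
Proof.
move=> /(cut_family_reindex _ _ (@enum_val_bij I)) /(introT (Omega_opP _ _)) w.
apply/(cut_family_reindex _ _ (@enum_val_bij I)).
exact: (elimT (Omega_opP _ _) (mop f w)).
Qed.

(** The edge [b] is completed by leaves to a cut above [a], which makes the pair part of one
    operation. *)
Lemma tree_map_below a b : below a b -> below (fe a) (fe b).
Proof.
move=> ab; have [x|x y|B [sB _ /tree_map_cut[h _ _]]] := @complete_cut S [set b] a.
- by move/set1P => ->.
- by move=> /set1P -> /set1P ->.
by have bB := subsetP sB _ (set11 b); apply: (h (exist _ b bB)).
Qed.

(** Incomparable edges lie in a common cut of the root, and its image is again an antichain. The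
    conclusion has no direction because [f] may identify comparable edges. *)
Lemma tree_map_comparable a b :
  below (fe a) (fe b) -> below a b \/ below b a.
Proof.
move=> fab; apply: contrapT => nab.
have [nab1 nab2] : ~ below a b /\ ~ below b a by split=> h; apply: nab; [left|right].
have [x|x y|B [sB _ /tree_map_cut[_ h _]]] := @complete_cut S [set a; b] (root S).
- by move=> _; apply: below_root.
- by rewrite !inE => /orP[]/eqP -> /orP[]/eqP ->.
have aB := subsetP sB _ (set21 a b); have bB := subsetP sB _ (set22 a b).
have /(congr1 val) /= e := h (exist _ a aB) (exist _ b bB) fab.
by apply: nab1; rewrite e below_refl.
Qed.

Lemma tree_map_below_strict a b :
  below (fe a) (fe b) -> fe a != fe b -> below a b.
Proof.
move=> fab; case: (tree_map_comparable fab) => // /tree_map_below ba.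
by rewrite (below_anti fab ba) eqxx.
Qed.

(** If [a] were the output of a vertex, the inputs of that vertex would be sent to a cut above a
    leaf, so one of them would have the same image as [a]. *)
Lemma tree_map_leaf a : injective fe -> leaf (fe a) -> leaf a.
Proof.
move=> fi la v ev; have /tree_map_cut[h1 _ h3] := vertex_cut v.
case: (h3 (fe a)) => [|[[x /= px]]|[w /la //]].
  by rewrite ev below_refl.
move=> xa; have := h1 (exist _ x px); rewrite /= ev => ax.
have /fi e := below_anti ax xa.
by have := down_neq (eqP px); rewrite (downE (eqP px)) ev e eqxx.
Qed.

Lemma inj_below a b : injective fe -> below (fe a) (fe b) = below a b.
Proof.
move=> fi; apply/idP/idP; last exact: tree_map_below.
case: (eqVneq (fe a) (fe b)) => [/fi-> _|ne h]; first exact: below_refl.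
exact: tree_map_below_strict.
Qed.

End TreeMaps.

(** The order conditions on a cut transfer from [f] because [o] is injective. Only covering can
    fail, at an edge of [U] that is the output of a vertex in [T] but perhaps not in [U]; the last
    hypothesis deals with exactly these edges. *)
Lemma tree_map_lift (S U T : tree) (o : tree_map U T) (f : tree_map S T)
    (g : edge S -> edge U) :
  injective (mcol o) -> (forall a, mcol o (g a) = mcol f a) ->
  (forall n (c : 'I_n -> edge S) d, cut_family c d ->
     forall x, below (g d) x -> (exists v, out v = mcol o x) ->
     (exists i, below (mcol f (c i) : edge T) (mcol o x)) \/ exists v, out v = x) ->
  exists h : tree_map S U, f = operad_map_comp o h.
Proof.
move=> oi og hg.
have gP n (c : 'I_n -> edge S) d : Omega_op c d -> Omega_op (fun i => g (c i)) (g d).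
  move=> w; have cw := elimT (Omega_opP _ _) w.
  have [h1 h2 h3] := tree_map_cut f cw.
  apply/Omega_opP; split=> [i|i j|x dx].
  - by rewrite -(inj_below _ _ oi) !og.
  - by rewrite -(inj_below _ _ oi) !og => /h2.
  have [|[i ix]|hv] := h3 (mcol o x); first by rewrite -og; apply: tree_map_below.
    by left; exists i; rewrite -(inj_below _ _ oi) og.
  by case: (hg _ _ _ cw x dx hv) => [[i ix]|]; [left; exists i; rewrite -(inj_below _
      _ oi) og|right].
by exists (mk_tree_map gP); apply: tree_map_ext => a /=; rewrite og.
Qed.

(* e is an inner edge of the subtree of T with root f (root S) and with the images
   under f of the leaves of S as leaves; e need not be in the image of f. *)
Definition interior (S T : tree) (f : tree_map S T) (e : edge T) : Prop :=
  [/\ below (mcol f (root S)) e, mcol f (root S) != e &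
      forall l : edge S, leaf l -> ~ below (mcol f l : edge T) e].

(** * Arrows that send a leaf to an edge or below it *)

Section LeafBelow.
Variables (S T : tree) (f : tree_map S T) (e : edge T).

Lemma exists_leaf_below :
  ~ interior f e -> below (mcol f (root S)) e -> mcol f (root S) != e ->
  exists2 l : edge S, leaf l & below (mcol f l) e.
Proof.
move=> ni h1 h2; apply: contrapT => nl; apply: ni; split=> // l ll le.
by apply: nl; exists l.
Qed.

Variable l : edge S.
Hypotheses (ll : leaf l) (le : below (mcol f l) e).

(** The edges [l] and [a] are comparable since their images are, and nothing lies strictly above the
    leaf [l]. Hence the image of [f] stops at [e]. *)
Lemma above_leaf_below a : below e (mcol f a) -> mcol f a = e.
Proof.
move=> ea; have [h|h] := tree_map_comparable (below_trans le ea).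
  by have := le; rewrite (above_leaf ll h) => ae; apply: below_anti.
by apply: below_anti => //; apply: below_trans (tree_map_below f h) le.
Qed.

Lemma cut_leaf_below (I : Type) (c : I -> edge S) d :
  cut_family c d -> below (mcol f d) e -> exists i, below (mcol f (c i)) e.
Proof.
case=> _ _ h3 de; have dl : below d l.
  case/orP: (below_total le de) => /tree_map_comparable[] //;
    by move/(above_leaf ll) <-; apply: below_refl.
case: (h3 l dl) => [[i il]|[w /ll //]]; exists i.
exact: below_trans (tree_map_below f il) le.
Qed.

End LeafBelow.

Lemma interior_comp (R S T : tree) (f : tree_map S T) (h : tree_map R S) (e : edge T) :
  interior (operad_map_comp f h) e -> interior f e.
Proof.
case=> /= h1 h2 h3.
have re : below (mcol f (root S) : edge T) (mcol f (mcol h (root R))).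
  by apply: tree_map_below; apply: below_root.
split.
- exact: below_trans re h1.
- apply: contra h2 => /eqP e'; apply/eqP; apply: below_anti => //.
  by rewrite -e'.
move=> l ll le.
have hl : below (mcol h (root R) : edge S) l.
  case/orP: (below_total le h1) => /tree_map_comparable[] //.
    by move/(above_leaf ll) => <-; apply: below_refl.
  by move/(above_leaf ll) => <-; apply: below_refl.
(* Completing the empty set gives the cut of the root by leaves of [R]. The leaf [l] is not the
   output of a vertex, so it lies above the image of one of them. *)
have [x|x y|B [_ hB cB]] := @complete_cut R set0 (root R); rewrite ?inE //.
have /(_ _ hl) := let: And3 _ _ h3 := tree_map_cut h cB in h3.
case=> [[[x xB] /= xl]|[v /ll //]].
have [|lx] := hB x xB; first by rewrite inE.
exact: h3 lx (below_trans (tree_map_below f xl) le).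
Qed.

Lemma interior_reflect (S T T' : tree) (q : tree_map T T') (f : tree_map S T)
    (e : edge T) :
  interior (operad_map_comp q f) (mcol q e : edge T') -> interior f e.
Proof.
case=> /= h1 h2 h3; split.
- exact: tree_map_below_strict h1 h2.
- by apply: contra h2 => /eqP ->.
by move=> l ll /(tree_map_below q); apply: h3.
Qed.

Lemma interior_inj (S T T' : tree) (q : tree_map T T') (f : tree_map S T)
    (e : edge T) : injective (mcol q) ->
  interior f e -> interior (operad_map_comp q f) (mcol q e : edge T').
Proof.
move=> qi [/= h1 h2 h3]; split=> /=.
- exact: tree_map_below.
- by apply: contra h2 => /eqP/qi ->.
by move=> l ll; rewrite inj_below //; apply: h3.
Qed.

(** The leaves of [S] are sent to a cut, none of whose members is below [e]; covering then makes [e]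
    the output of a vertex. *)
Lemma interior_inner (S T : tree) (f : tree_map S T) (e : edge T) :
  interior f e -> inner e.
Proof.
case=> h1 h2 h3; apply/andP; split.
  rewrite par_root; apply: contra h2 => /eqP ee; apply/eqP.
  by apply: below_anti => //; rewrite ee below_root.
have [x|x y|B [_ hB cB]] := @complete_cut S set0 (root S); rewrite ?inE //.
have /(_ _ h1) := let: And3 _ _ h3 := tree_map_cut f cB in h3.
case=> [[[x xB] /= xl]|[v ev]]; last by apply/existsP; exists v; rewrite ev.
have [|lx] := hB x xB; first by rewrite inE.
by case: (h3 x lx).
Qed.

(** * Faces and the number of vertices *)

Lemma face_map_inj (T : tree) (phi : face T) : injective (mcol (face_map phi)).
Proof.
case: phi => [e he|v hv|e he] /=; [exact: val_inj|exact: val_inj|].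
by move=> [] [].
Qed.

Lemma face_card (T : tree) (phi : face T) : #|vert (face_tree phi)| < #|vert T|.
Proof.
case: phi => [e he|v hv|e he] /=.
- have /andP[_ /existsP[v /eqP ev]] := he.
  rewrite card_sig; apply: proper_card; apply/properP; split; first exact/subsetP.
  by exists v; rewrite ?inE // ev eqxx.
- rewrite card_sig; apply: proper_card; apply/properP; split; first exact/subsetP.
  by exists v; rewrite ?inE // eqxx.
by rewrite card_void (eqP he).
Qed.

Lemma inner_card (T : tree) (e : edge T) : inner e -> 1 < #|vert T|.
Proof.
case/andP; case h: (par e) => [w|] // _ /existsP[v /eqP ev].
rewrite -(card1 w); apply: proper_card; apply/properP; split; first exact/subsetP.
exists v => //; rewrite inE; apply/eqP => vw.
by have := down_neq h; rewrite (downE h) -vw ev eqxx.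
Qed.

Lemma exists_inner (T : tree) : 1 < #|vert T| -> exists e : edge T, inner e.
Proof.
move=> /card_gt1P[v [w [_ _ vw]]].
have h (u : vert T) : out u != root T -> inner (out u).
  by move=> hu; rewrite /inner par_root hu; apply/existsP; exists u.
case: (eqVneq (out v) (root T)) => [ev|/h]; last by exists (out v).
exists (out w); apply: h; apply: contra vw => /eqP ew.
by apply/eqP/out_inj; rewrite ev.
Qed.

(** An outer face deletes only outer edges, and an inner face only the contracted edge. A single
    edge is a face only of a tree with one vertex, which has no inner edge. *)
Lemma face_lift (T : tree) (e : edge T) (he : inner e) (phi : face T) :
  phi <> FaceInner he -> exists e', mcol (face_map phi) e' = e.
Proof.
case: phi => [e' he'|v hv|a ha] /= h.
- have ne : e != e'.
    by apply: contra_notN h => /eqP ee; case: e' / ee he' => he'; congr FaceInner;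
        apply: bool_irrelevance.
  by exists (exist _ e ne).
- have k : kept v e by rewrite /kept he andbF.
  by exists (exist _ e k).
by have := inner_card he; rewrite (eqP ha).
Qed.

(** * The strict inner Kan condition for families given as relations *)

Section Kan.
Variable X : dset.
Hypothesis HX : strict_inner_kan X.

Definition yoneda (T : tree) (x : X T) : dmor (representable T) X :=
  @DMor (representable T) X (fun S f => dres f x) (fun R S g f => dres_comp f g x).

Lemma face_in_horn (T : tree) (e : edge T) (he : inner e) (phi : face T) :
  phi <> FaceInner he -> in_horn he (face_map phi).
Proof.
by exists phi => //; exists (operad_map_id _); rewrite operad_map_comp1r.
Qed.

Lemma kan_unique (T : tree) (e : edge T) (he : inner e) (x y : X T) :
  (forall phi : face T, phi <> FaceInner he ->
     dres (face_map phi) x = dres (face_map phi) y) -> x = y.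
Proof.
move=> h; have /bij_inj inj := HX he.
have /inj e' : dmor_comp (yoneda x) (horn_incl he) =
    dmor_comp (yoneda y) (horn_incl he).
  apply: dmor_ext => S [f [phi hphi [g e']]] /=.
  by rewrite e' !dres_comp h.
by have := congr1 (fun f : dmor (representable T) X => f T (operad_map_id _)) e';
    rewrite /= !dres_id.
Qed.

(* A relation on elements of X over the arrows to T plays the part of a section
   over a sieve. *)
Definition functional (T : tree) (R : forall S, tree_map S T -> X S -> Prop) :=
  forall S (f : tree_map S T) y y', R S f y -> R S f y' -> y = y'.

Definition natural (T : tree) (R : forall S, tree_map S T -> X S -> Prop) :=
  forall S' S (h : tree_map S' S) (f : tree_map S T) y,
    R S f y -> R S' (operad_map_comp f h) (dres h y).

Lemma kan_exists (T : tree) (e : edge T) (he : inner e)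
    (R : forall S, tree_map S T -> X S -> Prop) :
  functional R -> natural R ->
  (forall phi : face T, phi <> FaceInner he -> exists y, R _ (face_map phi) y) ->
  exists x : X T, forall phi : face T, phi <> FaceInner he ->
    R _ (face_map phi) (dres (face_map phi) x).
Proof.
move=> Rf Rn Re.
have Rh S (f : horn he S) : {y | R S (sval f) y}.
  apply: cid; case: f => f [phi /Re[y yR] [g e']] /=; rewrite e'.
  by exists (dres g y); apply: Rn.
(* Functionality makes the chosen values canonical: both sides are related by [R] to the same
   arrow. *)
have nat S' S (h : tree_map S' S) (f : horn he S) :
    sval (Rh _ (dres h f)) = dres h (sval (Rh _ f)).
  by apply: Rf (svalP (Rh _ (dres h f))) _; apply: Rn; apply: (svalP (Rh _ f)).
have [g _ gK] := HX he.
pose s : dmor (horn he) X := DMor nat.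
exists (g s T (operad_map_id _)) => phi hphi.
have := congr1 (fun t : dmor (horn he) X => t _ (exist _ _ (face_in_horn hphi) : horn
    he _)) (gK s).
rewrite /= -dnat /= operad_map_comp1l => ->.
exact: (svalP (Rh _ (exist _ _ (face_in_horn hphi) : horn he _))).
Qed.

End Kan.

(** * Joins, corollas and expanded corollas *)

Section Join.
Variables (I : finType) (T : I -> tree).

Definition join_edge : finType := option {i : I & edge (T i)}.
Definition join_vert : finType := option {i : I & vert (T i)}.

Definition jedge i (a : edge (T i)) : join_edge := Some (Tagged (fun i => edge (T i))
    a).
Definition jvert i (v : vert (T i)) : join_vert := Some (Tagged (fun i => vert (T i))
    v).

Definition join_out (v : join_vert) : join_edge :=
  if v is Some (existT i v) then jedge (out v) else None.

Definition join_par (a : join_edge) : option join_vert :=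
  if a is Some (existT i a) then
    Some (if par a is Some v then jvert v else None)
  else None.

Lemma jedge_inj i : injective (@jedge i).
Proof. by move=> a b [] /eqP; rewrite eq_Tagged /= => /eqP. Qed.

Lemma join_down i (a : edge (T i)) :
  descend join_out join_par (jedge a) =
  if a == root (T i) then None else jedge (down a).
Proof.
rewrite -par_root /descend /= /down /descend.
by case: (par a).
Qed.

Lemma join_iter i (a : edge (T i)) k :
  iter k (descend join_out join_par) (jedge a) = None \/
  iter k (descend join_out join_par) (jedge a) = jedge (iter k (@down _) a).
Proof.
elim: k => [|k /= [->|->]]; [by right|by left|].
by rewrite join_down; case: eqP; [left|right].
Qed.

Lemma join_connect i (a b : edge (T i)) :
  below a b -> fconnect (descend join_out join_par) (jedge b) (jedge a).
Proof.
move/belowP => [k]; elim: k b => [|k IH] b; first by move=> /= ->; apply: connect0.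
rewrite iterSr; case: (eqVneq b (root (T i))) => [->|nb].
  by rewrite down_root; apply: IH.
move=> /IH h; apply: connect_trans h; have := join_down b.
by rewrite (negPf nb) => <-; apply: fconnect1.
Qed.

Lemma join_conn (a : join_edge) : fconnect (descend join_out join_par) a None.
Proof.
case: a => [[i a]|]; last exact: connect0.
apply: connect_trans (join_connect (below_root a)) _.
by have := join_down (root (T i)); rewrite eqxx => <-; apply: fconnect1.
Qed.

Lemma join_out_inj : injective join_out.
Proof.
case=> [[i v]|] [[j w]|] //= [] e; case: j / e w => w /eqP.
by rewrite eq_Tagged /= => /eqP/out_inj ->.
Qed.

Lemma join_par_root a : (join_par a == None) = (a == None).
Proof. by case: a => [[i a]|]. Qed.

(* The trees T i with their roots attached as the inputs of a new root vertex. *)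
Definition join : tree := Tree join_out_inj join_par_root join_conn.

Lemma join_below i (a b : edge (T i)) :
  below (jedge a : edge join) (jedge b) = below a b.
Proof.
apply/idP/idP; last exact: join_connect.
case/belowP=> k; case: (join_iter b k); rewrite /down /= => -> //.
by move/jedge_inj <-; apply/belowP; exists k.
Qed.

Lemma join_below_tag i j (a : edge (T i)) (b : edge (T j)) :
  below (jedge a : edge join) (jedge b) -> i = j.
Proof.
case/belowP=> k; case: (join_iter b k); rewrite /down /= => -> //.
by case.
Qed.

Lemma join_below_root i (a : edge (T i)) : below (jedge a : edge join) None = false.
Proof.
apply/negP => h; have := below_anti h (below_root _).
by [].
Qed.

Lemma join_leaf i (a : edge (T i)) : leaf (jedge a : edge join) <-> leaf a.
Proof.
split=> la; first by move=> v ev; apply: (la (jvert v)); rewrite /= ev.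
case=> [[j v]|] //= [] e; case: i / e a la => a la.
by move/eqP; rewrite eq_Tagged => /eqP; apply: la.
Qed.

Lemma jedge_proof i n (c : 'I_n -> edge (T i)) d :
  Omega_op c d -> Omega_op (fun k => jedge (c k) : edge join) (jedge d).
Proof.
move=> /Omega_opP[h1 h2 h3]; apply/Omega_opP; split=> [k|k l|[[j x]|]].
- by rewrite join_below.
- by rewrite join_below; apply: h2.
- move=> dx; have e := join_below_tag dx; case: j / e x dx => x.
  rewrite join_below => /h3[[k kx]|[v <-]]; last by right; exists (jvert v).
  by left; exists k; rewrite join_below.
by rewrite join_below_root.
Qed.

Definition join_in i : tree_map (T i) join := mk_tree_map (@jedge_proof i).

Section JoinMap.
Variables (S : tree) (d : edge S) (f : forall i, tree_map (T i) S).
Hypothesis hf : cut_family (fun i => mcol (f i) (root (T i))) d.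

Definition join_map_fun (a : edge join) : edge S :=
  if a is Some (existT i a) then mcol (f i) a else d.

Lemma join_map_proof n (c : 'I_n -> edge join) r :
  Omega_op c r -> Omega_op (fun k => join_map_fun (c k)) (join_map_fun r).
Proof.
have [d1 d2 d3] := hf.
have fr i (a : edge (T i)) : below (mcol (f i) (root (T i))) (mcol (f i) a : edge S).
  by apply: tree_map_below; apply: below_root.
have fd i (a : edge (T i)) : below d (mcol (f i) a) by apply: below_trans (d1 _) (fr
    i a).
move=> /Omega_opP[h1 h2 h3].
have mono a b : below a b -> below (join_map_fun a) (join_map_fun b).
  case: a b => [[i a]|] [[j b]|] /= h //; last exact: below_refl.
    have e := join_below_tag h; case: j / e b h => b.
    by rewrite join_below; apply: tree_map_below.
  by have := join_below_root a; rewrite /jedge /Tagged h.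
have comp a b : below (join_map_fun a) (join_map_fun b) -> below a b \/ below b a.
  case: a b => [[i a]|] [[j b]|] /=; try by [left; apply: below_root|right; apply:
      below_root].
  move=> h; have e : i = j.
    have h' := below_trans (fr i a) h.
    by case/orP: (below_total h' (fr j b)) => /d2.
  case: j / e b h => b /tree_map_comparable.
  by rewrite !join_below.
(* Covering above the image of an edge [a] that has no member of [c] strictly below it: the members
   of [c] above [a] form a cut within [T i], to which [f i] applies. *)
have loc i (a : edge (T i)) : below r (jedge a) ->
    (forall k, below (c k) (jedge a) -> c k = jedge a) ->
    forall x, below (mcol (f i) a : edge S) x ->
    (exists k, below (join_map_fun (c k)) x) \/ exists v, out v = x.
  move=> ra hk x ax; pose B := [set b | below a b & [exists k, c k == jedge b]].
  have cB : cut_family (fun b : {b | b \in B} => val b) a.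
    split=> [[b] /=|[b hb] [b' hb'] /= bb'|y ay].
    - by rewrite inE => /andP[].
    - apply: val_inj => /=; move: hb hb' bb'; rewrite !inE.
      case/andP=> _ /existsP[k /eqP ek] /andP[_ /existsP[l /eqP el]].
      rewrite -join_below -ek -el => /h2 e; apply: (@jedge_inj i).
      by rewrite -ek -el e.
    case: (h3 (jedge y)) => [||[[[j v]|] //= [] /esym e]].
    - by apply: below_trans ra _; rewrite join_below.
    - case=> k; case ek: (c k) => [[j b]|]; last first.
        by have := hk k; rewrite ek => h _; have /h := below_root (jedge a : edge join).
      move=> by'; have /esym e := join_below_tag by'; case: j / e b ek by' => b ek.
      rewrite join_below => by'; left.
      suff bB : b \in B by exists (exist _ b bB).
      rewrite inE; apply/andP; split; last by apply/existsP; exists k; apply/eqP.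
      case/orP: (below_total by' ay) => // ba.
      have := hk k; rewrite ek (join_below b a) => /(_ ba)/jedge_inj ->.
      exact: below_refl.
    case: j / e v => v /eqP; rewrite eq_Tagged => /eqP /= ev.
    by right; exists v.
  have [_ _ /(_ _ ax)] := tree_map_cut (f i) cB.
  case=> [[[b hb] /= bx]|]; last by right.
  move: hb; rewrite inE => /andP[_ /existsP[k /eqP ek]].
  by left; exists k; rewrite ek.
apply/Omega_opP; split=> [k|k l /comp[/h2 //|/h2 //]|x rx].
- exact: mono.
case er: r rx => [[i a]|] /= rx.
  apply: loc rx => [|k kr]; first by rewrite er below_refl.
  by apply: below_anti => //; have := h1 k; rewrite er.
case: (pselect (exists k, c k = None)) => [[k ek]|nk].
  by left; exists k; rewrite ek.
case: (d3 x rx) => [[i ix]|]; last by right.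
apply: loc ix => [|k]; first by rewrite er; apply: below_root.
case ek: (c k) => [[j b]|]; last by case: nk; exists k.
move=> br; have /esym e := join_below_tag br; case: j / e b ek br => b ek.
rewrite join_below => br; congr jedge.
by apply: below_anti => //; apply: below_root.
Qed.

Definition join_map : tree_map join S := mk_tree_map join_map_proof.

Lemma join_map_in i : operad_map_comp join_map (join_in i) = f i.
Proof. exact: tree_map_ext. Qed.

End JoinMap.
End Join.

Definition corolla (I : finType) : tree := join (fun _ : I => eta).

Definition input (I : finType) (i : I) : edge (corolla I) :=
  @jedge I (fun _ => eta) i (tt : edge eta).

Lemma input_leaf (I : finType) (i : I) : leaf (input i).
Proof. by apply: (proj2 (@join_leaf I (fun _ => eta) i tt)); case. Qed.

Lemma corolla_edge (I : finType) (P : edge (corolla I) -> Prop) :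
  P None -> (forall i, P (input i)) -> forall a, P a.
Proof. by move=> h0 h1 [[i []]|] //; apply: h1. Qed.

Definition corolla_map (I : finType) (T : tree) (c : I -> edge T) (d : edge T)
    (h : cut_family c d) : tree_map (corolla I) T :=
  @join_map I (fun _ => eta) T d (fun i => edge_map (c i)) h.

Lemma corolla_cut (I : finType) : cut_family (@input I) None.
Proof.
split=> [i|i j|]; first exact: below_root.
  exact: (@join_below_tag I (fun _ => eta)).
apply: corolla_edge => [_|i _]; first by right; exists None.
by left; exists i; apply: below_refl.
Qed.

Lemma corolla_map_inj (I : finType) (T : tree) (c : I -> edge T) (d : edge T)
    (h : cut_family c d) : (forall i, c i <> d) -> injective (mcol (corolla_map h)).
Proof.
move=> cd; apply: corolla_edge => [|i]; apply: corolla_edge => [|j] //=.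
- by move/esym/cd.
- by move/cd.
by move/(cut_family_inj h) ->.
Qed.

(* The corolla with an edge inserted between the root vertex and the inputs in J. *)
Definition expanded_corolla (I : finType) (J : {set I}) : tree :=
  join (fun o : option {i | i \notin J} =>
    if o is None then corolla {i | i \in J} else eta).

Section ExpandedInputs.
Variables (I : finType) (J : {set I}).
Local Notation leg := (fun o : option {i | i \notin J} =>
    if o is None then corolla {i | i \in J} else eta).

Definition expanded_edge : edge (expanded_corolla J) :=
  @jedge _ leg None (root (corolla {i | i \in J})).

Definition expanded_input (i : I) : edge (expanded_corolla J) :=
  match pselect (i \in J) with
  | left h => @jedge _ leg None (input (exist _ i h))
  | right h => @jedge _ leg (Some (exist _ i (introN idP h))) (tt : edge eta)
  end.

Lemma expanded_input_cut : cut_family expanded_input (root _).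
Proof.
split=> [i|i j|[[[o|] a]|]]; first exact: below_root.
- rewrite /expanded_input.
  case: pselect => hi; case: pselect => hj.
  + by rewrite (join_below (T := leg)) => /(join_below_tag (T := fun _ => eta)) [].
  + by move/join_below_tag.
  + by move/join_below_tag.
  by move/join_below_tag => -[].
- case: o a => i hi [] _; left; exists i; rewrite /expanded_input.
  case: pselect => hi'; first by case/negP: hi.
  by rewrite (bool_irrelevance (introN idP hi') hi) below_refl.
- move: a; apply: corolla_edge => [|[i hi]] _.
    by right; exists (@jvert _ leg None None).
  left; exists i; rewrite /expanded_input.
  case: pselect => hi' //.
  by rewrite (bool_irrelevance hi' hi) below_refl.
by right; exists None.
Qed.

End ExpandedInputs.

Section Expand.
Variables (I : finType) (J : {set I}) (T : tree) (c : I -> edge T) (d e : edge T).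
Hypotheses (hc : cut_family c d) (de : below d e).
Hypotheses (hJ : forall i, (i \in J) = below e (c i)) (ne : forall i, ~ below (c i) e).

Lemma expand_top_cut : cut_family (fun i : {i | i \in J} => c (val i)) e.
Proof.
case: hc => h1 h2 h3; split=> [[i /= iJ]|i j /h2/val_inj //|x ex].
  by rewrite -hJ.
case: (h3 x) => [||]; [exact: below_trans ex| |by right].
case=> i ix; left; have iJ : i \in J.
  by rewrite hJ; case/orP: (below_total ex ix) => // /ne.
by exists (exist _ i iJ).
Qed.

Lemma expand_bot_cut :
  cut_family (fun o : option {i | i \notin J} => if o is Some i then c (val i) else
      e) d.
Proof.
case: hc => h1 h2 h3; split=> [[i|] //|[[i hi]|] [[j hj]|] //= h|x dx].
- by congr Some; apply: val_inj; apply: h2.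
- by case: (ne h).
- by case/negP: hj; rewrite hJ.
case: (h3 x dx) => [[i ix]|]; last by right.
case: (boolP (i \in J)) => [|iJ]; last by left; exists (Some (exist _ i iJ)).
rewrite hJ => ei; left; exists None; exact: below_trans ei ix.
Qed.

Definition expand_leg (o : option {i | i \notin J}) :
  tree_map (if o is None then corolla {i | i \in J} else eta) T :=
  if o is Some i then edge_map (c (val i)) else corolla_map expand_top_cut.

Lemma expand_leg_cut :
  cut_family (fun o => mcol (expand_leg o) (root _) : edge T) d.
Proof.
suff -> : (fun o => mcol (expand_leg o) (root _) : edge T) =
    (fun o : option {i | i \notin J} => if o is Some i then c (val i) else e).
  exact: expand_bot_cut.
by apply: funext => -[].
Qed.

Definition expand_map : tree_map (expanded_corolla J) T := join_map expand_leg_cut.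

Lemma expand_mapK :
  operad_map_comp expand_map (corolla_map (expanded_input_cut J)) = corolla_map hc.
Proof.
apply: tree_map_ext; apply: corolla_edge => //= i.
by rewrite /expanded_input; case: pselect.
Qed.

End Expand.

(** * Trees with at most one vertex *)

Section SmallTrees.
Variable T : tree.

(** Here and in [tree1_corolla], exhibiting [T] as a retract is enough: an element over [T] is
    recovered from its restriction by restricting along [r]. *)
Lemma tree0_eta : #|vert T| = 0 ->
  exists r : tree_map T eta, operad_map_comp (edge_map (root T)) r = operad_map_id _.
Proof.
move=> T0; have nv (v : vert T) : False by have := fintype0 v T0.
have eT (a : edge T) : root T = a.
  by apply/eqP; rewrite eq_sym -par_root; case: (par a) => // v; case: (nv v).
have [||n c d w x _ [v]|r] := @tree_map_lift T eta T (edge_map (root T))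
  (operad_map_id _) (fun _ => tt); last by exists r.
- by case=> -[].
- by move=> a /=; apply: eT.
by case: (nv v).
Qed.

Lemma tree1_corolla : #|vert T| = 1 ->
  exists n (k : tree_map (corolla 'I_n) T) (r : tree_map T (corolla 'I_n)),
    operad_map_comp k r = operad_map_id _.
Proof.
move/eqP/fintype1P => [v hv].
have pv (a : edge T) : a != root T -> par a = Some v.
  by rewrite -par_root; case: (par a) => // w _; rewrite (hv w).
have ev : out v = root T.
  apply/eqP; apply: contraT => /pv h.
  by have := down_neq h; rewrite (downE h) eqxx.
pose A : finType := {x | par x == Some v}.
have hA (x : edge T) (h : x != root T) : par x == Some v by rewrite pv.
have hc := proj1 (cut_family_reindex _ _ (@enum_val_bij A)) (vertex_cut v).
exists #|A|, (corolla_map hc).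
have gP (a : edge T) : exists b, mcol (corolla_map hc) b = a.
  case: (boolP (a != root T)) => [h|].
    by exists (input (enum_rank (exist _ a (hA a h) : A))); rewrite /= enum_rankK.
  by rewrite negbK => /eqP ->; exists None.
have [g kg] := choice gP.
have [||n c d w x _ [u eu]|r] := @tree_map_lift T _ T (corolla_map hc)
  (operad_map_id _) g.
- apply: corolla_map_inj => i /= h; have : par (sval (enum_val i)) == Some v := valP
    (enum_val i).
  rewrite h => /eqP h'.
  by have := down_neq h'; rewrite (downE h') eqxx.
- by move=> a /=; apply: kg.
- right; move: x eu; apply: corolla_edge => [|i] /= eu; first by exists None.
  have : par (sval (enum_val i)) == Some v := valP (enum_val i).
  rewrite -eu (hv u) => /eqP h.
  by have := down_neq h; rewrite (downE h) eqxx.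
by exists r.
Qed.

End SmallTrees.

(** At an inner edge, uniqueness of horn fillers passes the question to faces with fewer vertices. A
    tree without inner edges is a retract of [eta] or of a corolla. *)
Lemma small_unique (X : dset) (HX : strict_inner_kan X) (T : tree) (x y : X T) :
  (forall e : edge T, edge_col x e = edge_col y e) ->
  (forall n (f : tree_map (corolla 'I_n) T), dres f x = dres f y) -> x = y.
Proof.
have [m] := ubnP #|vert T|; elim: m => // m IH in T x y *; rewrite ltnS => hT he hc.
case hT1 : (1 < #|vert T|).
  have [e ie] := exists_inner hT1.
  apply: (kan_unique HX (he := ie)) => phi _; apply: IH.
  - exact: leq_trans (face_card phi) hT.
  - by move=> a; rewrite !edge_col_res.
  by move=> n f; rewrite -!dres_comp.
case hT0 : #|vert T| hT1 => [|[|k]] // _.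
  have [r rK] := tree0_eta hT0.
  by rewrite -(dres_id x) -(dres_id y) -rK !dres_comp; congr dres; apply: he.
have [n [k [r rK]]] := tree1_corolla hT0.
by rewrite -(dres_id x) -(dres_id y) -rK !dres_comp hc.
Qed.

(** * Extension along an inner edge *)

Lemma expanded_corolla_ext (I : finType) (J : {set I}) (T : tree)
    (p q : tree_map (expanded_corolla J) T) :
  operad_map_comp p (corolla_map (expanded_input_cut J)) =
    operad_map_comp q (corolla_map (expanded_input_cut J)) ->
  mcol p (expanded_edge J) = mcol q (expanded_edge J) -> p = q.
Proof.
move=> h he.
have {}h a : mcol p (mcol (corolla_map (expanded_input_cut J)) a) =
    mcol q (mcol (corolla_map (expanded_input_cut J)) a) by exact: (congr1 (fun f =>
        mcol f a) h).
apply: tree_map_ext => -[[[i|] a]|]; last exact: (h None).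
  case: i a => i hi [] /=; have := h (input i); rewrite /= /expanded_input.
  case: pselect => hi'; first by case/negP: hi.
  by rewrite (bool_irrelevance (introN idP hi') hi).
move: a; apply: corolla_edge => [|[i hi]]; first exact: he.
have := h (input i); rewrite /= /expanded_input.
by case: pselect => // hi'; rewrite (bool_irrelevance hi' hi).
Qed.

Lemma expand_corolla (I : finType) (J : {set I}) (T : tree) (e : edge T)
    (f : tree_map (corolla I) T) :
  interior f e -> (forall i, (i \in J) = below e (mcol f (input i))) ->
  exists2 q : tree_map (expanded_corolla J) T,
    operad_map_comp q (corolla_map (expanded_input_cut J)) = f &
    mcol q (expanded_edge J) = e.
Proof.
case=> h1 h2 h3 hJ.
have ne i : ~ below (mcol f (input i)) e by apply: h3; apply: input_leaf.
exists (expand_map (tree_map_cut f (@corolla_cut I)) h1 hJ ne); last by [].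
by rewrite expand_mapK; apply: tree_map_ext; apply: corolla_edge.
Qed.

Lemma eta_not_interior (T : tree) (f : tree_map eta T) (e : edge T) : ~ interior f e.
Proof. by case=> h _ /(_ tt) []; first by case. Qed.

Lemma leaf_not_inner (T : tree) (x : edge T) : leaf x -> inner x = false.
Proof.
by move=> lx; apply/negP => /andP[_ /existsP[w /eqP]]; apply: lx.
Qed.

Section TopEdge.
Variables (T : tree) (v : vert T).
Hypotheses (hi : inner (out v)) (top : forall x, below (out v) x -> x = out v \/ leaf
    x).

Lemma above_top x : below (out v) x -> x = out v \/ par x = Some v.
Proof.
case: (eqVneq x (out v)) => [->|nx vx]; first by left.
have [_ _ /(_ _ vx)] := vertex_cut v.
case=> [[[y /= py] yx]|[w ew]].
  have vy : below (out v) y by rewrite -(downE (eqP py)) below_down.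
  case: (top vy) => [ey|/above_leaf/(_ yx) <-]; last by right; apply/eqP.
  by have := down_neq (eqP py); rewrite (downE (eqP py)) ey eqxx.
by case: (top vx) => [e|/(_ w)//]; rewrite e eqxx in nx.
Qed.

Lemma input_top_leaf x : par x = Some v -> leaf x.
Proof.
move=> px; have : below (out v) x by rewrite -(downE px) below_down.
case/top => // ex; have := down_neq px.
by rewrite (downE px) ex eqxx.
Qed.

Lemma top_outer_vertex : outer_vertex v.
Proof.
apply/cards1P; exists (out v); apply/setP => x; rewrite !inE /attached.
case: (eqVneq x (out v)) => [->|nx] /=; first by rewrite hi.
apply/negP => /andP[/eqP/input_top_leaf].
by move/leaf_not_inner ->.
Qed.

Definition vertex_map : tree_map (corolla {x | par x == Some v}) T :=
  corolla_map (vertex_cut v).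

Lemma vertex_map_inj : injective (mcol vertex_map).
Proof.
apply: corolla_map_inj => -[x /= /eqP px] e.
by have := down_neq px; rewrite (downE px) e eqxx.
Qed.

(** If the root of [S] is sent to [out v] or above, the whole image lies in the corolla of [v].
    Otherwise the image could reach the inputs of [v] only by passing [out v], and then a leaf sent
    to [out v] or below blocks it. *)
Lemma not_interior_factor (S : tree) (f : tree_map S T) :
  ~ interior f (out v) ->
  (exists g, f = operad_map_comp (outer_face top_outer_vertex) g) \/
  exists g, f = operad_map_comp vertex_map g.
Proof.
move=> ni; case: (boolP (below (out v) (mcol f (root S)))) => [vr|nvr].
  right; have gP (a : edge S) : exists b, mcol vertex_map b = mcol f a.
    have : below (out v) (mcol f a).
      exact: below_trans vr (tree_map_below f (below_root a)).
    case/above_top => [->|/eqP px]; first by exists None.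
    by exists (input (exist (fun x => par x == Some v) _ px)).
  have [g hg] := choice gP.
  apply: (tree_map_lift vertex_map_inj hg) => n c d _ x _ [u eu]; right.
  move: x eu; apply: corolla_edge => [|[x px]] /= eu; first by exists None.
  by case: (input_top_leaf (eqP px) eu).
left; have hl a : below (mcol f (root S)) (mcol f a) by apply/tree_map_below/below_root.
have low : below (mcol f (root S)) (out v) ->
    exists2 l : edge S, leaf l & below (mcol f l) (out v).
  move=> h; apply: exists_leaf_below => //.
  by apply: contra nvr => /eqP ->; apply: below_refl.
have kept_f a : kept v (mcol f a).
  rewrite /kept negb_and negbK /attached; case: (eqVneq (out v) (mcol f a)) =>
      [<-|ne] /=.
    by rewrite hi ?orbT.
  apply/orP; left; apply/eqP => pa.
  have va : below (out v) (mcol f a) by rewrite -(downE pa) below_down.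
  have [|l ll lv] := low.
    by have := below_total (hl a) va; rewrite (negPf nvr) orbF.
  by case/eqP: ne; apply/esym; apply: above_leaf_below va.
have gP (a : edge S) : exists b : edge (prune top_outer_vertex),
    mcol (outer_face top_outer_vertex) b = mcol f a.
  by exists (exist (fun x => kept v x) _ (kept_f a)).
have [g hg] := choice gP.
have oi : injective (mcol (outer_face top_outer_vertex)) by exact: val_inj.
apply: (tree_map_lift oi hg) => n c d cd x dx [u eu].
(* The face lacks no vertex but [v]; when [u] is [v], the edge [out v] is covered by the cut because
   of the blocking leaf. *)
case: (eqVneq u v) => [uv|nuv]; last first.
  right; exists (exist (fun w => w != v) u nuv : vert (prune top_outer_vertex)).
  by apply: val_inj.
left; have dv : below (mcol f d) (out v).
  by rewrite -uv eu -hg; apply: tree_map_below.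
have [l ll lv] := low (below_trans (hl d) dv).
by have [i iv] := cut_leaf_below ll lv cd dv; exists i; rewrite -eu uv.
Qed.

(** A second inner edge can be contracted without touching the corolla of [v]. If there is none, the
    vertex [w] below [out v] is outer, and the face that deletes it contains this corolla. The
    filler of the horn is thereby controlled on the corolla of [v]. *)
Lemma vertex_map_in_face :
  exists2 phi : face T, phi <> FaceInner hi &
    exists g, vertex_map = operad_map_comp (face_map phi) g.
Proof.
case: (pselect (exists2 e', inner e' & e' != out v)) => [[e' he' ne]|only].
  exists (FaceInner he').
    move=> /(congr1 (fun phi => if phi is FaceInner e _ then e else root T)) /= e.
    by rewrite e eqxx in ne.
  have gP a : exists b : edge (contract he'),
      mcol (inner_face he') b = mcol vertex_map a.
    have h : mcol vertex_map a != e'.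
      move: a; apply: corolla_edge => [|[x px]] /=; first by rewrite eq_sym.
      by apply: contraTneq he' => <-; rewrite leaf_not_inner //;
          apply/input_top_leaf/eqP.
    by exists (exist (fun x => x != e') _ h).
  have [g hg] := choice gP.
  apply: (tree_map_lift (face_map_inj (phi := FaceInner he')) hg).
  move=> n c d _ x _ [u eu]; right.
  have h : out u != e' by rewrite eu; apply: (valP x).
  exists (exist (fun u => out u != e') u h : vert (contract he')).
  by apply: val_inj.
have /andP[] := hi; case pw : (par (out v)) => [w|] // _ _.
have uniq x : inner x -> x = out v.
  by move=> ix; apply: contrapT => /eqP nx; apply: only; exists x.
have hw : outer_vertex w.
  apply/cards1P; exists (out v); apply/setP => x; rewrite !inE /attached.
  case: (eqVneq x (out v)) => [->|nx]; first by rewrite hi pw eqxx orbT.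
  by apply/negP => /andP[_ /uniq e]; rewrite e eqxx in nx.
exists (FaceOuter hw) => //.
have nwv : w != v.
  by apply/eqP => e; have := down_neq pw; rewrite (downE pw) e eqxx.
have gP a : exists b : edge (prune hw), mcol (outer_face hw) b = mcol vertex_map a.
  have h : kept w (mcol vertex_map a).
    rewrite /kept; move: a; apply: corolla_edge => [|[x px]] /=.
      by rewrite hi andbF.
    rewrite negb_and /attached; apply/orP; left; apply/negP => /orP[/eqP|].
      exact/input_top_leaf/eqP.
    by rewrite (eqP px) => /eqP[] e; rewrite e eqxx in nwv.
  by exists (exist (fun x => kept w x) _ h).
have [g hg] := choice gP.
apply: (tree_map_lift (face_map_inj (phi := FaceOuter hw)) hg).
move=> n c d _ x dx [u eu]; right.
case: (eqVneq u w) => [uw|nuw]; last first.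
  by exists (exist (fun u => u != w) u nuw : vert (prune hw)); apply: val_inj.
have vx : below (out v) (out u).
  rewrite eu; apply: below_trans (tree_map_below (outer_face hw) dx).
  by rewrite (hg d); apply: (tree_map_below vertex_map (below_root d)).
rewrite uw in vx; case/eqP: (down_neq pw); rewrite (downE pw).
by apply: below_anti => //; rewrite -(downE pw) below_down.
Qed.

End TopEdge.

Section Extension.
Variable X : dset.
Hypothesis HX : strict_inner_kan X.

(** Every face in the horn at [e] contains [e], and the hypothesis passes to it by
    [interior_reflect]. The induction ends when [e] is not interior to the identity, where the
    hypothesis applies to the identity itself. *)
Lemma unique_off_edge (T : tree) (e : edge T) (x y : X T) :
  (forall S (f : tree_map S T), ~ interior f e -> dres f x = dres f y) -> x = y.
Proof.
have [m] := ubnP #|vert T|; elim: m => // m IH in T e x y *; rewrite ltnS => hT h.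
case: (pselect (interior (operad_map_id (Omega T)) e)) => [ie|ne]; last first.
  by have := h _ _ ne; rewrite !dres_id.
apply: (kan_unique HX (he := interior_inner ie)) => phi /face_lift[e' he'].
apply: (IH _ e'); first exact: leq_trans (face_card phi) hT.
move=> S f nf; rewrite -!dres_comp; apply: h.
by rewrite -he' => /interior_reflect.
Qed.

Lemma extend_off_edge (T : tree) (e : edge T)
    (R : forall S, tree_map S T -> X S -> Prop) :
  (forall x, below e x -> x = e \/ leaf x) -> functional R -> natural R ->
  (forall S (f : tree_map S T), ~ interior f e -> exists y, R S f y) ->
  exists x : X T, forall S (f : tree_map S T), ~ interior f e -> R S f (dres f x).
Proof.
have [m] := ubnP #|vert T|; elim: m => // m IH in T e R *.
rewrite ltnS => hT top Rf Rn Rt.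
case: (pselect (interior (operad_map_id (Omega T)) e)) => [ie|/Rt[y Ry]]; last first.
  by exists y => S f _; have := Rn _ _ f _ _ Ry; rewrite operad_map_comp1l.
have he := interior_inner ie; have /andP[_ /existsP[v /eqP ev]] := he.
case: e / ev ie top Rt he => ie top Rt he.
(* An element over a face that obeys [R] wherever [R] is known to be total. *)
pose good (phi : face T) (y : X (face_tree phi)) :=
  forall S (g : tree_map S (face_tree phi)),
    ~ interior (operad_map_comp (face_map phi) g) (out v) ->
    R S (operad_map_comp (face_map phi) g) (dres g y).
have exg (phi : face T) : phi <> FaceInner he -> exists y, good phi y.
  move=> /face_lift[e' he']; have fi := @face_map_inj T phi.
  have [|x|S f y y'|S' S h f y|S f nf|y hy] := IH (face_tree phi) e'
    (fun S g y => R S (operad_map_comp (face_map phi) g) y).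
  - exact: leq_trans (face_card phi) hT.
  - rewrite -(inj_below _ _ fi) he' => /top[]; last by right; apply: tree_map_leaf fi _.
    by rewrite -he' => /fi; left.
  - exact: Rf.
  - by rewrite operad_map_compA; apply: Rn.
  - by apply: Rt; rewrite -he' => /interior_reflect.
  exists y => S g ng; apply: hy => ig; apply: ng; rewrite -he'.
  exact: interior_inj.
(* The family to be filled consists of restrictions of good elements. [R] itself may relate nothing
   to a face that has [out v] in its interior. *)
pose H S (f : tree_map S T) y :=
  exists (phi : face T) (z : X (face_tree phi)) (g : tree_map S (face_tree phi)),
  [/\ phi <> FaceInner he, good phi z, f = operad_map_comp (face_map phi) g & y =
      dres g z].
have Hf : functional H.
  move=> S f y y' [phi [z [g [hphi zP fE ->]]]] [psi [w [h [hpsi wP fE' ->]]]].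
  apply: (small_unique HX) => [a|n k].
    rewrite /edge_col -!dres_comp; apply: (Rf _ (operad_map_comp f (edge_map a))).
      by rewrite fE -operad_map_compA; apply: zP; apply: eta_not_interior.
    by rewrite fE' -operad_map_compA; apply: wP; apply: eta_not_interior.
  rewrite -!dres_comp; set fk := operad_map_comp f k.
  have fkE : fk = operad_map_comp (face_map phi) (operad_map_comp g k).
    by rewrite operad_map_compA -fE.
  have fkE' : fk = operad_map_comp (face_map psi) (operad_map_comp h k).
    by rewrite operad_map_compA -fE'.
  case: (pselect (interior fk (out v))) => ik; last first.
    by apply: (Rf _ fk); [rewrite {1}fkE; apply: zP|rewrite {1}fkE'; apply: wP];
        rewrite -?fkE -?fkE'.
  (* Both elements restrict to the corolla expanded by e, where they agree because
     R prescribes them away from e. *)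
  pose J := [set i | below (out v) (mcol fk (input i) : edge T)].
  have expand (chi : face T) (l : tree_map _ (face_tree chi)) :
      chi <> FaceInner he -> fk = operad_map_comp (face_map chi) l ->
      exists q : tree_map (expanded_corolla J) (face_tree chi),
      [/\ operad_map_comp q (corolla_map (expanded_input_cut J)) = l &
        mcol (face_map chi) (mcol q (expanded_edge J)) = out v].
    move=> /face_lift[e' he'] lE.
    have [||q ql qe] := @expand_corolla _ J _ e' l; last by exists q; rewrite ql qe.
      by apply: (@interior_reflect _ _ _ (face_map chi)); rewrite -lE he'.
    move=> i; rewrite inE -he' -(inj_below _ _ (@face_map_inj _ chi)) lE //.
  have [q [qg qe]] := expand _ _ hphi fkE.
  have [r [rh re]] := expand _ _ hpsi fkE'.
  have qr : operad_map_comp (face_map phi) q = operad_map_comp (face_map psi) r.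
    apply: expanded_corolla_ext; last by rewrite /= qe re.
    by rewrite -!operad_map_compA qg rh -fkE.
  have /unique_off_edge e : forall S (f : tree_map S (expanded_corolla J)),
      ~ interior f (expanded_edge J) -> dres f (dres q z) = dres f (dres r w).
    move=> S' f' nf; rewrite -!dres_comp.
    have nq : ~ interior (operad_map_comp (operad_map_comp (face_map phi) q) f') (out
        v).
      by rewrite -qe => /interior_reflect.
    apply: (Rf _ (operad_map_comp (operad_map_comp (face_map phi) q) f')).
      by rewrite -operad_map_compA; apply: zP; rewrite operad_map_compA.
    by rewrite qr -operad_map_compA; apply: wP; rewrite operad_map_compA -qr.
  by rewrite -qg -rh !dres_comp e.
have Hn : natural H.
  move=> S' S k f y [phi [z [g [hphi zP -> ->]]]].
  exists phi, z, (operad_map_comp g k); split=> //; first by rewrite operad_map_compA.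
  by rewrite dres_comp.
have Ht (phi : face T) z : phi <> FaceInner he -> good phi z -> H _ (face_map phi) z.
  move=> hphi zP; exists phi, z, (operad_map_id _); split=> //.
    by rewrite operad_map_comp1r.
  by rewrite dres_id.
have [phi hphi|x xP] := kan_exists HX Hf Hn (he := he).
  by have [z zP] := exg phi hphi; exists z; apply: Ht.
have {}xP (phi : face T) : phi <> FaceInner he -> good phi (dres (face_map phi) x).
  move=> hphi; have [z zP] := exg phi hphi.
  by rewrite (Hf _ _ _ _ (xP _ hphi) (Ht _ _ hphi zP)).
exists x => S f nf; have [[g fE]|[g fE]] := not_interior_factor he top nf.
  rewrite fE dres_comp; apply: (xP (FaceOuter (top_outer_vertex he top))) => //.
  by rewrite -fE.
have [phi hphi [g' vE]] := vertex_map_in_face he top.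
rewrite fE dres_comp; apply: Rn; rewrite vE dres_comp; apply: xP => //.
(* The root of the corolla of [v] is sent to [out v], which is therefore not interior. *)
rewrite -vE; case=> _; rewrite eqxx.
by [].
Qed.

End Extension.

(** * The Segal condition *)

(** An inner edge of maximal depth works: an edge strictly above it that is the output of a vertex
    would be inner and deeper. *)
Lemma exists_top_edge (T : tree) (e : edge T) : inner e ->
  exists2 v : vert T, inner (out v) &
    forall x, below (out v) x -> x = out v \/ leaf x.
Proof.
move=> he; pose depth (x : edge T) := #|[set y | below y x]|.
case: (arg_maxnP depth he) => a ia amax; have /andP[_ /existsP[v /eqP ev]] := ia.
exists v; rewrite ev // => x ax; case: (pselect (x = a)) => [|nx]; [by left|right].
move=> w ew; have ix : inner x.
  rewrite /inner par_root; apply/andP; split; last by apply/existsP; exists w;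
      rewrite ew.
  apply/eqP => ex; have /andP[] := ia; rewrite par_root.
  by case/eqP; apply: below_anti; rewrite ?below_root // -ex.
have := amax x ix; rewrite /= leqNgt => /negP; apply; apply: proper_card.
apply/properP; split; first by apply/subsetP => y; rewrite !inE => h; apply:
    below_trans h ax.
exists x; rewrite !inE ?below_refl //; apply/negP => xa.
by apply: nx; apply: below_anti.
Qed.

(** The subtree spanned by [f] has no inner edge, hence at most one vertex. *)
Definition elementary (S T : tree) (f : tree_map S T) : Prop :=
  forall e, ~ interior f e.

Lemma elementary_comp (R S T : tree) (f : tree_map S T) (h : tree_map R S) :
  elementary f -> elementary (operad_map_comp f h).
Proof. by move=> ef e /interior_comp; apply: ef. Qed.

Lemma elementary_inj (R S T : tree) (f : tree_map S T) (h : tree_map R S) :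
  injective (mcol f) -> elementary (operad_map_comp f h) -> elementary h.
Proof. by move=> fi efh e /(interior_inj fi); apply: efh. Qed.

Lemma elementary_outer_face (S T : tree) (v : vert T) (hv : outer_vertex v)
    (g : tree_map S (prune hv)) :
  elementary g -> elementary (operad_map_comp (outer_face hv) g).
Proof.
move=> eg e ie; have ke : kept v e by rewrite /kept (interior_inner ie) andbF.
have := @interior_reflect _ _ _ (outer_face hv) g (exist (fun x => kept v x) e ke) ie.
exact: eg.
Qed.

Lemma elementary_vertex_map (T : tree) (v : vert T) :
  (forall x, below (out v) x -> x = out v \/ leaf x) -> elementary (vertex_map v).
Proof.
move=> top e ie; have [/= h1 h2 _] := ie.
case: (top e h1) => [e'|/leaf_not_inner]; first by rewrite e' eqxx in h2.
by rewrite (interior_inner ie).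
Qed.

Lemma elementary_id (T : tree) :
  (forall e : edge T, ~~ inner e) -> elementary (operad_map_id (Omega T)).
Proof. by move=> h e /interior_inner; apply/negP. Qed.

Lemma tree_map_inj_eq (S U T : tree) (o : tree_map U T) (g h : tree_map S U) :
  injective (mcol o) -> operad_map_comp o g = operad_map_comp o h -> g = h.
Proof.
move=> oi e; apply: tree_map_ext => a; apply: oi.
exact: (congr1 (fun f : tree_map S T => mcol f a) e).
Qed.

Section Segal.
Variable X : dset.
Hypothesis HX : strict_inner_kan X.

Lemma segal_unique (T : tree) (x y : X T) :
  (forall S (f : tree_map S T), elementary f -> dres f x = dres f y) -> x = y.
Proof.
have [m] := ubnP #|vert T|; elim: m => // m IH in T x y *; rewrite ltnS => hT h.
case: (pselect (exists e : edge T, inner e)) => [[e he]|nin]; last first.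
  rewrite -(dres_id x) -(dres_id y); apply/h/elementary_id => e.
  by apply/negP => he; apply: nin; exists e.
have [v iv top] := exists_top_edge he.
apply: (unique_off_edge HX (e := out v)) => S f.
case/(not_interior_factor iv top) => -[g ->]; rewrite !dres_comp; last first.
  by rewrite (h _ _ (elementary_vertex_map top)).
congr dres; apply: IH; first exact: leq_trans (face_card (FaceOuter _)) hT.
by move=> S' f' ef'; rewrite -!dres_comp; apply/h/elementary_outer_face.
Qed.

Lemma segal_exists (T : tree) (R : forall S, tree_map S T -> X S -> Prop) :
  functional R -> natural R ->
  (forall S (f : tree_map S T), elementary f -> exists y, R S f y) ->
  exists x : X T, forall S (f : tree_map S T), elementary f -> R S f (dres f x).
Proof.
have [m] := ubnP #|vert T|; elim: m => // m IH in T R *; rewrite ltnS => hT Rf Rn Rt.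
case: (pselect (exists e : edge T, inner e)) => [[e he]|nin]; last first.
  have [|y Ry] := Rt _ (operad_map_id (Omega T)).
    by apply: elementary_id => e; apply/negP => he; apply: nin; exists e.
  by exists y => S f _; have := Rn _ _ f _ _ Ry; rewrite operad_map_comp1l.
have [v iv top] := exists_top_edge he; pose o := outer_face (top_outer_vertex iv top).
have oi : injective (mcol o) := @face_map_inj T (FaceOuter _).
have [|S f y y'|S' S h f y|S f ef|u uP] := IH (prune (top_outer_vertex iv top))
  (fun S g y => R S (operad_map_comp o g) y).
- exact: leq_trans (face_card (FaceOuter (top_outer_vertex iv top))) hT.
- exact: Rf.
- by rewrite operad_map_compA; apply: Rn.
- exact/Rt/elementary_outer_face.
(* [extend_off_edge] asks for a value on every arrow without [out v] in its interior, while [R] is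
   total only on elementary arrows. On arrows into the pruned tree the value comes from [u]; such
   factorizations are unique because [o] is injective. *)
pose R' S (f : tree_map S T) y :=
  (exists2 g, f = operad_map_comp o g & y = dres g u) \/ (elementary f /\ R S f y).
have R'R S (f : tree_map S T) y : elementary f -> R' S f y -> R S f y.
  move=> ef [[g fE ->]|[]//]; rewrite fE; apply: uP.
  by apply: (elementary_inj oi); rewrite -fE.
have [||S f nf|x xP] := @extend_off_edge X HX T (out v) R' top.
- move=> S f y y' h h'; case: (pselect (elementary f)) => [ef|nef].
    by apply: Rf (R'R _ _ _ ef h) (R'R _ _ _ ef h').
  case: h h' => [[g fE ->]|[]//] [[g' fE' ->]|[]//]; congr dres.
  by apply: (tree_map_inj_eq oi); rewrite -fE.
- move=> S' S h f y [[g -> ->]|[ef Rfy]].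
    by left; exists (operad_map_comp g h); rewrite ?operad_map_compA ?dres_comp.
  by right; split; [apply: elementary_comp|apply: Rn].
- case: (not_interior_factor iv top nf) => -[g fE].
    by exists (dres g u); left; exists g.
  have ef : elementary f by rewrite fE; apply/elementary_comp/elementary_vertex_map.
  by have [y Ry] := Rt _ _ ef; exists y; right.
by exists x => S f ef; apply: R'R => //; apply: xP.
Qed.

End Segal.

(** * The Segal condition for trees grafted onto a corolla *)

Section JoinSegal.
Variables (I : finType) (T : I -> tree).

Lemma join_root_cut :
  cut_family (fun i => jedge (root (T i)) : edge (join T)) None.
Proof.
split=> [i|i j|[[i a]|] _]; first exact: below_root.
- exact: join_below_tag.
- by left; exists i; rewrite join_below below_root.
by right; exists None.
Qed.

Definition join_root : tree_map (corolla I) (join T) := corolla_map join_root_cut.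

Lemma join_root_inj : injective (mcol join_root).
Proof. exact: corolla_map_inj. Qed.

Lemma join_in_inj i : injective (mcol (join_in T i)).
Proof. exact: jedge_inj. Qed.

(** Suppose the root of [S] is sent to the root of the join. The root of each [T i] is not interior,
    so a leaf of [S] is sent to it or below, and the image does not continue into [T i]. *)
Lemma elementary_join (S : tree) (f : tree_map S (join T)) : elementary f ->
  (exists g, f = operad_map_comp join_root g) \/
  exists i g, f = operad_map_comp (join_in T i) g.
Proof.
move=> ef; case er : (mcol f (root S)) => [[i r]|].
  right; exists i.
  have gP (a : edge S) : exists b, mcol (join_in T i) b = mcol f a.
    have := tree_map_below f (below_root a); rewrite er.
    case: (mcol f a) => [[j b]|] h; last by have := join_below_root r; rewrite h.
    by have e := join_below_tag h; case: j / e b {h} => b; exists b.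
  have [g hg] := choice gP.
  apply: (tree_map_lift (@join_in_inj i) hg) => n c d _ x _ [[[j v]|] //= [] /esym e].
  case: j / e v => v /eqP; rewrite eq_Tagged => /eqP /= ev.
  by right; exists v.
left; have low i : exists2 l : edge S, leaf l & below (mcol f l) (jedge (root (T i))).
  by apply: (exists_leaf_below (ef _)); rewrite er // below_root.
have gP (a : edge S) : exists b, mcol join_root b = mcol f a.
  case ea : (mcol f a) => [[i b]|]; last by exists None.
  exists (input i); have [l ll le] := low i.
  have := above_leaf_below ll le (a := a); rewrite ea => -> //.
  by rewrite join_below below_root.
have [g hg] := choice gP.
apply: (tree_map_lift join_root_inj hg) => n c d cd; apply: corolla_edge => [|i] dx _.
  by right; exists None.
left; have [l ll le] := low i; apply: (cut_leaf_below ll le cd).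
by rewrite -hg; apply: (tree_map_below join_root dx).
Qed.

Variable X : dset.
Hypothesis HX : strict_inner_kan X.

Lemma join_unique (x y : X (join T)) :
  dres join_root x = dres join_root y ->
  (forall i, dres (join_in T i) x = dres (join_in T i) y) -> x = y.
Proof.
move=> h0 h; apply: (segal_unique HX) => S f /elementary_join[[g ->]|[i [g ->]]].
  by rewrite !dres_comp h0.
by rewrite !dres_comp h.
Qed.

(** Together with [join_unique], this makes [X (join T)] a fibre product over the colours at the
    grafted edges. *)
Lemma join_exists (z : X (corolla I)) (y : forall i, X (T i)) :
  (forall i, edge_col z (input i) = edge_col (y i) (root (T i))) ->
  exists x : X (join T), dres join_root x = z /\
    forall i, dres (join_in T i) x = y i.
Proof.
move=> zy.
pose R S (f : tree_map S (join T)) u :=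
  (exists2 g, f = operad_map_comp join_root g & u = dres g z) \/
  exists i, exists2 g, f = operad_map_comp (join_in T i) g & u = dres g (y i).
(* An arrow that factors both ways is constant at the grafted edge, so it factors through [eta],
   where the hypothesis compares the two colours. *)
have mixed S (g : tree_map S (corolla I)) i (h : tree_map S (T i)) :
    operad_map_comp join_root g = operad_map_comp (join_in T i) h ->
    dres g z = dres h (y i).
  move=> e; have {}e a : mcol join_root (mcol g a) = mcol (join_in T i) (mcol h a).
    exact: (congr1 (fun f : tree_map S _ => mcol f a) e).
  have ga a : mcol g a = input i.
    move: (mcol g a) (e a); apply: corolla_edge => // j [] ji _.
    by rewrite ji.
  have ha a : mcol h a = root (T i).
    by apply: (@jedge_inj _ T); have := e a; rewrite ga.
  have [||n c d _ x _ [v ev]|k gE] := @tree_map_lift S eta _ (edge_map (input i)) g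
      (fun _ => tt).
  - by case=> -[].
  - by move=> a /=; rewrite ga.
  - by case: (input_leaf ev).
  have -> : h = operad_map_comp (edge_map (root (T i))) k.
    by apply: tree_map_ext => a; rewrite ha.
  by rewrite gE !dres_comp; congr dres; apply: zy.
have Rf : functional R.
  move=> S f u u' [[g fE ->]|[i [g fE ->]]] [[g' fE' ->]|[i' [g' fE' ->]]].
  - by congr dres; apply: (tree_map_inj_eq join_root_inj); rewrite -fE.
  - by apply: mixed; rewrite -fE.
  - by apply/esym/mixed; rewrite -fE.
  have ii : i = i'.
    have := congr1 (fun f : tree_map S _ => mcol f (root S)) (etrans (esym fE) fE').
    by case.
  case: i' / ii g' fE' => g' fE'; congr dres.
  by apply: (tree_map_inj_eq (@join_in_inj i)); rewrite -fE.
have Rr : R _ join_root z.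
  by left; exists (operad_map_id _); rewrite ?operad_map_comp1r ?dres_id.
have Ri i S f : R S (operad_map_comp (join_in T i) f) (dres f (y i)).
  by right; exists i, f.
have [//||S f ef|x xP] := @segal_exists X HX _ R.
- move=> S' S h f u [[g -> ->]|[i [g -> ->]]].
    by left; exists (operad_map_comp g h); rewrite ?operad_map_compA ?dres_comp.
  by right; exists i, (operad_map_comp g h); rewrite ?operad_map_compA ?dres_comp.
- case: (elementary_join ef) => [[g fE]|[i [g fE]]].
    by exists (dres g z); left; exists g.
  by exists (dres g (y i)); right; exists i, g.
exists x; split=> [|i].
  apply: Rf Rr; apply: xP => -[[i a]|] [_ //= _ h].
  by apply: (h (input i)); [apply: input_leaf|rewrite join_below below_root].
(* The inclusion of [T i] need not be elementary, so the restriction to [T i] is identified through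
   elementary arrows into it. *)
apply: (segal_unique HX) => S f ef; rewrite -dres_comp; apply: Rf (Ri i S f).
apply: xP => -[[j a]|] ie; have [h _ _] := ie; last first.
  by have := join_below_root (mcol f (root S)); rewrite [X in X = _]h.
have e := join_below_tag h; case: j / e a ie {h} => a.
by move/(@interior_reflect _ _ _ (join_in T i)); apply: ef.
Qed.

End JoinSegal.

(** * Values of terms *)

Definition op_map (T : tree) n (c : 'I_n -> edge T) d (w : Omega_op c d) :
  tree_map (corolla 'I_n) T := corolla_map (elimT (Omega_opP c d) w).

Definition corolla_op n : Omega_op (@input 'I_n) None :=
  introT (Omega_opP _ _) (@corolla_cut 'I_n).

Lemma op_map_corolla n : op_map (corolla_op n) = operad_map_id _.
Proof. by apply: tree_map_ext; apply: corolla_edge. Qed.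

Lemma op_map_mop (S T : tree) (f : tree_map S T) n (c : 'I_n -> edge S) d
    (w : op (o := Omega S) c d) :
  operad_map_comp f (op_map w) = op_map (mop f w).
Proof. by apply: tree_map_ext; apply: corolla_edge. Qed.

Definition join_op n (T : 'I_n -> tree) :
    Omega_op (fun i => jedge (root (T i)) : edge (join T)) None :=
  introT (Omega_opP _ _) (join_root_cut T).

Lemma op_map_join n (T : 'I_n -> tree) : op_map (join_op T) = join_root T.
Proof. by apply: tree_map_ext; apply: corolla_edge. Qed.

Lemma edge_map_eta : edge_map (tt : edge eta) = operad_map_id _.
Proof. by apply: tree_map_ext => -[]. Qed.

Section Evaluation.
Variable X : dset.
Hypothesis HX : strict_inner_kan X.

Lemma edge_col_eta (a : X eta) : edge_col a (tt : edge eta) = a.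
Proof. by rewrite /edge_col edge_map_eta dres_id. Qed.

Definition xop n (c : 'I_n -> X eta) (d : X eta) : Type :=
  {y : X (corolla 'I_n) | (forall i, edge_col y (input i) = c i) /\
                          edge_col y (None : edge (corolla 'I_n)) = d}.

(** [Omega_op] is a proposition, so equal words of inputs force [w] and [w'] to be the same
    operation. Each operad law for [xop] thus reduces to an equality of words of edges in one
    tree. *)
Lemma xop_opeq d n (c : 'I_n -> X eta) (y : xop c d) m (c' : 'I_m -> X eta)
    (y' : xop c' d) (T : tree) (x : X T) (a : 'I_n -> edge T) r (w : Omega_op a r)
    (a' : 'I_m -> edge T) (w' : Omega_op a' r) :
  sval y = dres (op_map w) x -> sval y' = dres (op_map w') x ->
  existT _ n a = existT _ m a' :> profile (edge T) -> opeq y y'.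
Proof.
move=> hy hy' e; have en : n = m := congr1 (@projT1 _ _) e.
case: m / en c' y' a' w' hy' e => c' y' a' w' hy' e.
have {e} e : a = a' by exact: existT_inj e.
case: a' / e w' hy' => w'; rewrite (bool_irrelevance w' w) -hy => {hy} e.
have ec : c = c'.
  by apply: funext => i; rewrite -(proj1 (svalP y)) -(proj1 (svalP y')) e.
case: c' / ec y' e => y' e; congr existT.
by case: y y' e => y yP [y' y'P] /= e; apply: eq_exist.
Qed.

Lemma op_map_col (T : tree) (x : X T) n (c : 'I_n -> edge T) d (w : Omega_op c d)
    (c' : 'I_n -> X eta) (d' : X eta) :
  (fun i => edge_col x (c i)) = c' -> edge_col x d = d' ->
  (forall i, edge_col (dres (op_map w) x) (input i) = c' i) /\
  edge_col (dres (op_map w) x) (None : edge (corolla 'I_n)) = d'.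
Proof. by move=> <- <-; split=> *; rewrite edge_col_res. Qed.

Definition xval (T : tree) (x : X T) n (c : 'I_n -> edge T) d (w : Omega_op c d)
    (c' : 'I_n -> X eta) (d' : X eta)
    (ec : (fun i => edge_col x (c i)) = c') (ed : edge_col x d = d') : xop c' d' :=
  exist _ (dres (op_map w) x) (op_map_col w ec ed).

(** Restriction of [a] along the degeneracy from the unary corolla to [eta]. *)
Definition xid (a : X eta) : xop (fun _ : 'I_1 => a) a :=
  xval (Omega_id (tt : edge eta)) (funext (fun _ => edge_col_eta a)) (edge_col_eta a).

Lemma xid_val (T : tree) (x : X T) e :
  sval (xid (edge_col x e)) = dres (op_map (Omega_id e)) x.
Proof.
rewrite /= /edge_col -dres_comp; congr dres.
by apply: tree_map_ext; apply: corolla_edge.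
Qed.

Lemma xop_col n (c : 'I_n -> X eta) d (y : xop c d) :
  (fun i => edge_col (sval y) (input i)) = c.
Proof. by apply: funext => i; rewrite (proj1 (svalP y)). Qed.

Lemma xop_root n (c : 'I_n -> X eta) d (y : xop c d) :
  edge_col (sval y) (None : edge (corolla 'I_n)) = d.
Proof. exact: proj2 (svalP y). Qed.

Lemma xop_self n (c : 'I_n -> X eta) d (y : xop c d) :
  sval y = dres (op_map (corolla_op n)) (sval y).
Proof. by rewrite op_map_corolla dres_id. Qed.

Definition xact n (c : 'I_n -> X eta) d (s : 'S_n) (y : xop c d) :
  xop (fun i => c (s i)) d :=
  xval (Omega_act s (corolla_op n)) (funext (fun i => proj1 (svalP y) (s i)))
      (xop_root y).

Lemma xact_val n (c : 'I_n -> X eta) d (s : 'S_n) (y : xop c d)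
    (T : tree) (x : X T) (a : 'I_n -> edge T) r (w : Omega_op a r) :
  sval y = dres (op_map w) x -> sval (xact s y) = dres (op_map (Omega_act s w)) x.
Proof.
move=> /= ->; rewrite -dres_comp; congr dres.
by apply: tree_map_ext; apply: corolla_edge.
Qed.

Definition two_level n (k : 'I_n -> nat) : tree := join (fun i => corolla 'I_(k i)).

Definition two_level_root n (k : 'I_n -> nat) :
    Omega_op (fun i => jedge (root (corolla 'I_(k i))) : edge (two_level k)) None :=
  join_op (fun i => corolla 'I_(k i)).

Definition two_level_top n (k : 'I_n -> nat) i :
    Omega_op (fun j => jedge (input j) : edge (two_level k))
      (jedge (root (corolla 'I_(k i)))) :=
  mop (join_in (fun i => corolla 'I_(k i)) i) (corolla_op (k i)).

Lemma op_map_top n (k : 'I_n -> nat) i :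
  op_map (two_level_top k i) = join_in (fun i => corolla 'I_(k i)) i.
Proof. by apply: tree_map_ext; apply: corolla_edge. Qed.

Definition two_level_op n (k : 'I_n -> nat) :
    Omega_op (concat (fun i j => jedge (input j) : edge (two_level k))) None :=
  Omega_comp (two_level_root k) (two_level_top k).

Lemma xcomp_ex n (c : 'I_n -> X eta) (d : X eta) (k : 'I_n -> nat)
    (b : forall i, 'I_(k i) -> X eta) (y : xop c d) (z : forall i, xop (b i) (c i)) :
  exists x : X (two_level k), sval y = dres (op_map (two_level_root k)) x /\
  forall i, sval (z i) = dres (op_map (two_level_top k i)) x.
Proof.
have [i|x [h0 h]] := @join_exists _ (fun i => corolla 'I_(k i)) X HX (sval y) (fun i
    => sval (z i)).
  by rewrite (proj1 (svalP y)) xop_root.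
exists x; split; first by rewrite op_map_join h0.
by move=> i; rewrite op_map_top h.
Qed.

Lemma xcomp_col n (c : 'I_n -> X eta) (d : X eta) (k : 'I_n -> nat)
    (b : forall i, 'I_(k i) -> X eta) (y : xop c d) (z : forall i, xop (b i) (c i))
    (x : X (two_level k)) : sval y = dres (op_map (two_level_root k)) x ->
  (forall i, sval (z i) = dres (op_map (two_level_top k i)) x) ->
  (fun p => edge_col x (concat (fun i j => jedge (input j) : edge (two_level k)) p))
      = concat b /\
  edge_col x (None : edge (two_level k)) = d.
Proof.
move=> h0 h; split; last by rewrite -(xop_root y) h0 edge_col_res.
apply: funext => p; rewrite /concat -(proj1 (svalP (z _))) h edge_col_res.
by [].
Qed.

Definition xcomp n (c : 'I_n -> X eta) (d : X eta) (k : 'I_n -> nat)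
    (b : forall i, 'I_(k i) -> X eta) (y : xop c d) (z : forall i, xop (b i) (c i)) :
        xop (concat b) d :=
  let x := cid (xcomp_ex y z) in
  let h := xcomp_col (proj1 (svalP x)) (proj2 (svalP x)) in
  xval (two_level_op k) (proj1 h) (proj2 h).

(** A composite may be computed in any tree that carries all its factors: the two-level tree maps to
    [S], and by [join_unique] the chosen filler is the restriction of [x]. *)
Lemma xcomp_val n (c : 'I_n -> X eta) (d : X eta) (k : 'I_n -> nat)
    (b : forall i, 'I_(k i) -> X eta) (y : xop c d) (z : forall i, xop (b i) (c i))
    (S : tree) (x : X S) (c0 : 'I_n -> edge S) d0
    (b0 : forall i, 'I_(k i) -> edge S) (w : Omega_op c0 d0)
    (w' : forall i, Omega_op (b0 i) (c0 i)) :
  sval y = dres (op_map w) x -> (forall i, sval (z i) = dres (op_map (w' i)) x) ->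
  sval (xcomp y z) = dres (op_map (Omega_comp w w')) x.
Proof.
move=> h0 h; rewrite /xcomp; case: cid => x2 /= [g0 g].
pose m : tree_map (two_level k) S :=
  @join_map _ (fun i => corolla 'I_(k i)) _ d0 (fun i => op_map (w' i)) (elimT
      (Omega_opP _ _) w).
have -> : x2 = dres m x.
  apply: (join_unique HX) => [|i]; rewrite -dres_comp.
    rewrite -op_map_join -g0 h0; congr dres.
    by apply: tree_map_ext; apply: corolla_edge.
  by rewrite join_map_in -h g op_map_top.
rewrite -dres_comp; congr dres.
by apply: tree_map_ext; apply: corolla_edge.
Qed.

Fixpoint eval n (c : 'I_n -> X eta) (d : X eta) (t : term c d) : xop c d :=
  match t in @term _ n c d return xop c d with
  | TGen T x n c d w c' d' ec ed => xval w ec ed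
  | TId a => xid a
  | TComp n c d k b t u => xcomp (eval t) (fun i => eval (u i))
  | TAct n c d s t => xact s (eval t)
  end.

Lemma eval_rel d n (c : 'I_n -> X eta) (t : term c d)
    m (c' : 'I_m -> X eta) (t' : term c' d) :
  term_rel t t' -> opeq (eval t) (eval t').
Proof.
elim=> {n c d t m c' t'}.
- by [].
- by move=> *; apply/esym.
- by move=> d n c t m c' t' l c'' t'' _ h _ h'; apply: etrans h h'.
- move=> n c d k b t t' u u' _ e _ h /=.
  have -> : eval t = eval t' by apply: existT_inj e.
  suff -> : (fun i => eval (u i)) = fun i => eval (u' i) by [].
  by apply: functional_extensionality_dep => i; apply: existT_inj (h i).
- move=> n c d s t t' _ e /=.
  by have -> : eval t = eval t' by apply: existT_inj e.
- move=> n c d t /=; have e := xop_self (eval t).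
  (* For both unit laws the common tree is the corolla of [eval t], with identities at its root or
     at its inputs. *)
  have h : sval (xid d) = dres (op_map (Omega_id (None : edge (corolla 'I_n))))
      (sval (eval t)).
    by rewrite -xid_val xop_root.
  apply: (xop_opeq (xcomp_val h (fun _ => e)) e); exact: profile_idl.
- move=> n c d t /=; have e := xop_self (eval t).
  have h i : sval (xid (c i)) = dres (op_map (Omega_id (input i))) (sval (eval t)).
    by rewrite -xid_val (proj1 (svalP (eval t))).
  apply: (xop_opeq (xcomp_val e h) e); exact: profile_idr.
- move=> n c d k b l a t u v /=.
  (* For associativity the common tree has three levels: the two-level trees of the composites of
     [u i] with [v i], grafted onto the corolla of [t]. *)
  pose cx i := cid (xcomp_ex (eval (u i)) (fun j => eval (v i j))).
  pose x2 i := sval (cx i); have x2P i := svalP (cx i).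
  pose T i := two_level (l i).
  have [i|x [h0 h]] := @join_exists _ T X HX (sval (eval t)) x2.
    have [e _] := x2P i.
    by rewrite (proj1 (svalP (eval t))) -(xop_root (eval (u i))) e edge_col_res.
  rewrite -op_map_join in h0.
  have h1 i : sval (eval (u i)) = dres (op_map (mop (join_in T i) (two_level_root (l
      i)))) x.
    by rewrite -op_map_mop dres_comp h; case: (x2P i).
  have h2 i j : sval (eval (v i j)) = dres (op_map (mop (join_in T i)
      (two_level_top (l i) j))) x.
    by rewrite -op_map_mop dres_comp h; have [_] := x2P i; apply.
  apply: (xop_opeq
    (xcomp_val (z := fun p => eval (v (tagnat.sig1 p) (tagnat.sig2 p)))
      (xcomp_val (esym h0) h1) (fun p => h2 (tagnat.sig1 p) (tagnat.sig2 p)))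
    (xcomp_val (esym h0) (fun i => xcomp_val (h1 i) (h2 i)))).
  exact: profile_concatA.
- move=> n c d t /=; apply: (xop_opeq (xact_val 1 (xop_self (eval t))) (xop_self
    (eval t))).
  by congr existT; apply: funext => i; rewrite perm1.
- move=> n c d r s t /=.
  apply: (xop_opeq (xact_val s (xact_val r (xop_self (eval t))))
                   (xact_val (s * r)%g (xop_self (eval t)))).
  by congr existT; apply: funext => i; rewrite permM.
- move=> n c d k b s t u /=; have [x [h0 h]] := xcomp_ex (eval t) (fun i => eval (u i)).
  apply: (xop_opeq (xcomp_val (xact_val s h0) (fun i => h (s i)))
                   (xact_val (block_perm k s) (xcomp_val h0 h))).
  exact: profile_block_perm.
- move=> n c d k b s t u /=; have [x [h0 h]] := xcomp_ex (eval t) (fun i => eval (u i)).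
  apply: (xop_opeq (xcomp_val h0 (fun i => xact_val (s i) (h i)))
                   (xact_val (sum_perm s) (xcomp_val h0 h))).
  exact: profile_sum_perm.
- move=> T x e /=; congr existT; apply: eq_exist; exact/esym/xid_val.
- move=> T x n c d k b w w' /=; congr existT; apply: eq_exist; apply/esym.
  exact: xcomp_val.
- move=> T x n c d s w /=; congr existT; apply: eq_exist; apply/esym.
  by apply: (xact_val s (y := xval w erefl erefl)).
- move=> S T p x n c d w c' d' ec ed ec' ed' /=; congr existT; apply: eq_exist.
  by rewrite -op_map_mop dres_comp.
Qed.

End Evaluation.

(** * Bijectivity of the unit *)

Section Agreement.
Variables (T : tree) (P : operad) (f g : operad_map (Omega T) P).
Hypothesis fg : mcol f = mcol g.

(** The colours of [f] and [g] are only provably equal, hence the casts; quantifying over their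
    proofs leaves each use free to choose them. *)
Definition agree n (c : 'I_n -> edge T) d (w : Omega_op c d) : Prop :=
  forall ec ed, op_cast ec ed (mop f (w : op (o := Omega T) c d)) = mop g w.

Lemma agree_all : (forall n (c : 'I_n -> edge T) d (w : Omega_op c d), agree w) -> f
    = g.
Proof.
move=> h; apply: operad_map_ext => [a|n c d w ec ed]; first by rewrite fg.
exact: h.
Qed.

Lemma agree_comp n (c : 'I_n -> edge T) d (k : 'I_n -> nat)
    (b : forall i, 'I_(k i) -> edge T) (w : Omega_op c d)
    (w' : forall i, Omega_op (b i) (c i)) :
  agree w -> (forall i, agree (w' i)) -> agree (Omega_comp w w').
Proof.
move=> h h' ec ed.
have ef n' (c' : 'I_n' -> edge T) : (fun i => mcol f (c' i)) = fun i => mcol g (c' i).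
  by rewrite fg.
have ef' c' : mcol f c' = mcol g c' by rewrite fg.
have e : Omega_comp w w' = ocomp (o := Omega T) w w' by apply: bool_irrelevance.
rewrite e mop_comp (@op_cast_ocomp P _ _ _ fg _ _ _ _ _ _ _ _ _
  (ef _ c) (ef' d) (fun i => ef _ (b i)) (fun i => ef' (c i))) h mop_comp.
congr ocomp; apply: functional_extensionality_dep => i; exact: h'.
Qed.

(** Inputs of an operation are distinct, so two operations with the same output and the same set of
    inputs differ by a permutation. This absorbs the order in which a composite lists its inputs. *)
Lemma agree_perm n (c : 'I_n -> edge T) d (w : Omega_op c d)
    m (c' : 'I_m -> edge T) (w' : Omega_op c' d) :
  (forall i, exists j, c' j = c i) -> (forall j, exists i, c i = c' j) ->
  agree w -> agree w'.
Proof.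
move=> /choice[t ht] /choice[s hs] h.
have ci := cut_family_inj (elimT (Omega_opP _ _) w).
have ci' := cut_family_inj (elimT (Omega_opP _ _) w').
have si : injective s by move=> j j' e; apply: ci'; rewrite -!hs e.
have ti : injective t by move=> i i' e; apply: ci; rewrite -!ht e.
have en : n = m.
  apply/eqP; rewrite eqn_leq; have := leq_card _ si; have := leq_card _ ti.
  by rewrite !card_ord => -> ->.
case: m / en c' w' t ht s hs ci' si ti => c' w' t ht s hs ci' si ti.
have ec' : (fun i => c (perm si i)) = c'.
  by apply: funext => i; rewrite permE hs.
case: c' / ec' w' {t ht hs ci' ti} => w' ec ed.
have -> : w' = oact (o := Omega T) (perm si) w by apply: bool_irrelevance.
have e3 : (fun i => mcol f (c i)) = fun i => mcol g (c i) by rewrite fg.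
have e4 : mcol f d = mcol g d by rewrite fg.
by rewrite !mop_act (@op_cast_oact P _ _ _ fg _ _ _ _ _ _ _ e3 e4) h.
Qed.

Lemma agree_id n (c : 'I_n -> edge T) d (w : Omega_op c d) k : c k = d -> agree w.
Proof.
move=> ck; have [h1 h2 _] := elimT (Omega_opP _ _) w.
have kE l : l = k by apply/esym/h2; rewrite ck.
apply: (agree_perm (w := Omega_id d)) => [i|j|ec ed].
- by exists k.
- by exists ord0; rewrite (kE j).
have -> : Omega_id d = oid (o := Omega T) d by apply: bool_irrelevance.
by rewrite !mop_id (op_cast_oid fg).
Qed.

Lemma agree_mop (S : tree) (p : tree_map S T) n (c : 'I_n -> edge S) d
    (w : op (o := Omega S) c d) :
  operad_map_comp f p = operad_map_comp g p -> agree (mop p w).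
Proof.
move=> e ec ed; exact: (@op_cast_mop (Omega S) P (operad_map_comp f p)
    (operad_map_comp g p)
  n c d w _ _ ec ed erefl erefl e).
Qed.

(** An operation with [e] in its interior is, up to a permutation, a composite of one that has [e]
    as an input with one that has [e] as output. The edge [e] is interior to neither. *)
Lemma agree_off_edge (e : edge T) :
  (forall n (p : tree_map (corolla 'I_n) T), ~ interior p e ->
     operad_map_comp f p = operad_map_comp g p) -> f = g.
Proof.
move=> h; have ag n (c : 'I_n -> edge T) d (w : Omega_op c d) :
    ~ interior (op_map w) e -> agree w.
  move=> /h/(agree_mop (corolla_op n)).
  by have -> : mop (op_map w) (corolla_op n) = w by apply: bool_irrelevance.
apply: agree_all => n c d w; case: (pselect (interior (op_map w) e)) => [ie|/ag//].
have cw := elimT (Omega_opP _ _) w; have [/= de nde nl] := ie.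
have ne i : ~ below (c i) e by apply: (nl (input i)); apply: input_leaf.
pose J := [set i | below e (c i)].
have hJ i : (i \in J) = below e (c i) by rewrite inE.
pose c1 (o : option {i | i \notin J}) := if o is Some i then c (val i) else e.
(* The leg over [e] is the upper part of the operation; over an input not above [e] it is an
   identity. *)
have legs o : exists (k : nat) (b : 'I_k -> edge T) (w : Omega_op b (c1 o)),
    [/\ agree w, forall j, exists i, c i = b j &
        forall i, below (c1 o) (c i) -> exists j, b j = c i].
  case: o => [[i hi]|] /=.
    exists 1, (fun _ => c i), (Omega_id (c i)); split.
    - exact: (@agree_id _ _ _ _ ord0).
    - by exists i.
    - by case: cw => _ h2 _ i' /h2 <-; exists ord0.
  have ct := proj1 (cut_family_reindex _ _ (@enum_val_bij _)) (expand_top_cut cw de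
      hJ ne).
  exists _, _, (introT (Omega_opP _ _) ct); split.
  - by apply: ag => -[/= _]; rewrite eqxx.
  - by move=> j; exists (val (enum_val j)).
  - move=> i; rewrite -hJ => iJ.
    by exists (enum_rank (exist (fun i => i \in J) i iJ)); rewrite /= enum_rankK.
pose k o := sval (cid (legs o)).
pose b o : 'I_(k o) -> edge T := sval (cid (svalP (cid (legs o)))).
pose w2 o : Omega_op (b o) (c1 o) := sval (cid (svalP (cid (svalP (cid (legs o)))))).
have w2P o : [/\ agree (w2 o), forall j, exists i, c i = b o j &
        forall i, below (c1 o) (c i) -> exists j, b o j = c i].
  exact: (svalP (cid (svalP (cid (svalP (cid (legs o))))))).
have cb := proj1 (cut_family_reindex _ _ (@enum_val_bij _)) (expand_bot_cut cw de hJ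
    ne).
pose w1 := introT (Omega_opP _ _) cb.
apply: (agree_perm (w := Omega_comp w1 (fun j => w2 (enum_val j)))).
- by move=> p; rewrite /concat; have [_ h2 _] := w2P (enum_val (tagnat.sig1 p));
    apply: h2.
- move=> i; have [o co] : exists o, below (c1 o) (c i).
    case: (boolP (i \in J)) => [|iJ]; first by rewrite hJ; exists None.
    by exists (Some (exist _ i iJ)); apply: below_refl.
  rewrite -(enum_rankK o) in co; have [_ _ /(_ i co)[j ej]] := w2P (enum_val
      (enum_rank o)).
  by exists (tagnat.Rank (enum_rank o) j); rewrite concat_Rank.
apply: agree_comp => [|j]; last by case: (w2P (enum_val j)).
apply: ag => -[_ _ /(_ (input (enum_rank None)))]; apply; first exact: input_leaf.
by rewrite /= enum_rankK below_refl.
Qed.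

End Agreement.

(** * Reduction of terms to generators over corollas, and bijectivity *)

Section Unit.
Variable X : dset.
Hypothesis HX : strict_inner_kan X.

Definition gen n (c : 'I_n -> X eta) d (y : xop c d) : term c d :=
  TGen (x := sval y) (corolla_op n : op (o := Omega (corolla 'I_n)) _ _)
    (xop_col y) (xop_root y).

(** Naturality of generators along [op_map w]. *)
Lemma gen_val n (c : 'I_n -> X eta) d (y : xop c d) (T : tree) (x : X T)
    (a : 'I_n -> edge T) r (w : Omega_op a r)
    (ec : (fun i => edge_col x (a i)) = c) (ed : edge_col x r = d) :
  sval y = dres (op_map w) x ->
  term_rel (gen y) (TGen (w : op (o := Omega T) a r) ec ed).
Proof.
rewrite /gen; move: (xop_col y) (xop_root y) => + + e; rewrite e => ec' ed'.
have := TRgen_nat (f := op_map w) (corolla_op n : op (o := Omega (corolla 'I_n)) _ _)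
  ec' ed' ec ed.
by have -> : mop (op_map w) (corolla_op n) = w by apply: bool_irrelevance.
Qed.

(** [TRgen_comp] for colours that are only provably those of [x]; [gen_act] and [gen_id] do the same
    for the other two relations. *)
Lemma gen_comp (T : tree) (x : X T) n (c0 : 'I_n -> edge T) d0
    (k : 'I_n -> nat) (b0 : forall i, 'I_(k i) -> edge T) (w : Omega_op c0 d0)
    (w' : forall i, Omega_op (b0 i) (c0 i))
    (c : 'I_n -> X eta) d (b : forall i, 'I_(k i) -> X eta)
    (ec : (fun i => edge_col x (c0 i)) = c) (ed : edge_col x d0 = d)
    (eb : forall i, (fun j => edge_col x (b0 i j)) = b i)
    (ec' : forall i, edge_col x (c0 i) = c i) e1 :
  term_rel (TComp (TGen (w : op (o := Omega T) _ _) ec ed)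
      (fun i => TGen (w' i : op (o := Omega T) _ _) (eb i) (ec' i)))
    (@TGen X T x _ (concat b0) d0 (Omega_comp w w') (concat b) d e1 ed).
Proof.
have e : (fun i j => edge_col x (b0 i j)) = b by apply: functional_extensionality_dep.
case: b / e eb e1 => eb e1; case: c / ec ec' => ec'; case: d / ed.
rewrite (Prop_irrelevance eb (fun i => erefl)) (Prop_irrelevance ec' (fun i => erefl)).
rewrite (Prop_irrelevance e1 erefl).
have := TRgen_comp x (w : op (o := Omega T) _ _) (fun i => w' i : op (o := Omega T) _
    _).
exact: TRsym.
Qed.

Lemma gen_act (T : tree) (x : X T) n (c0 : 'I_n -> edge T) d0 (s : 'S_n)
    (w : Omega_op c0 d0) (c : 'I_n -> X eta) d
    (ec : (fun i => edge_col x (c0 i)) = c) (ed : edge_col x d0 = d) e1 :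
  term_rel (TAct s (TGen (w : op (o := Omega T) _ _) ec ed))
    (@TGen X T x _ (fun i => c0 (s i)) d0 (Omega_act s w) (fun i => c (s i)) d e1 ed).
Proof.
case: c / ec e1 => e1; case: d / ed; rewrite (Prop_irrelevance e1 erefl).
exact/TRsym/(TRgen_act x s (w : op (o := Omega T) _ _)).
Qed.

Lemma gen_id (a a' : X eta) (ec : (fun _ : 'I_1 => edge_col a (tt : edge eta)) = fun
    _ => a')
    (ed : edge_col a (tt : edge eta) = a') :
  term_rel (TGen (Omega_id (tt : edge eta) : op (o := Omega eta) _ _) ec ed) (TId a').
Proof.
case: a' / ed ec => ec; rewrite (Prop_irrelevance ec erefl).
exact: TRgen_id.
Qed.

(** For a composite, the generators of all the factors are moved to the two-level tree, where they
    compose by a defining relation. Hence an operation of [tau X] is determined by its value. *)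
Lemma term_gen n (c : 'I_n -> X eta) d (t : term c d) : term_rel t (gen (eval HX t)).
Proof.
elim: t => {n c d} [T x n c d w c' d' ec ed|a|n c d k b t IHt u IHu|n c d s t IHt] /=.
- exact/TRsym/gen_val.
- apply: TRtrans (TRsym (gen_id (funext (fun _ => edge_col_eta a)) (edge_col_eta a))) _.
  exact/TRsym/gen_val.
- have [x [h0 h]] := xcomp_ex HX (eval HX t) (fun i => eval HX (u i)).
  apply: TRtrans (TRcomp IHt IHu) _.
  have hc i : edge_col x (jedge (root (corolla 'I_(k i))) : edge (two_level k)) = c i.
    by rewrite -(xop_root (eval HX (u i))) h edge_col_res.
  have hd : edge_col x (None : edge (two_level k)) = d.
    by rewrite -(xop_root (eval HX t)) h0 edge_col_res.
  have hb i : (fun j => edge_col x (jedge (input j) : edge (two_level k))) = b i.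
    apply: funext => j; rewrite -(proj1 (svalP (eval HX (u i)))) h edge_col_res //.
  have hcb : (fun p => edge_col x (concat (fun i j => jedge (input j) : edge
      (two_level k)) p))
      = concat b.
    by apply: funext => p; rewrite /concat -hb.
  apply: TRtrans (TRcomp (gen_val (funext hc) hd h0) (fun i => gen_val (hb i) (hc i)
      (h i))) _.
  apply: TRtrans (gen_comp _ _ _ _ _ _ hcb) _.
  exact: TRsym (gen_val hcb hd (xcomp_val HX h0 h)).
apply: TRtrans (TRact s IHt) _.
have e := xop_self (eval HX t).
have e1 : (fun i => edge_col (sval (eval HX t)) (input (s i))) = fun i => c (s i).
  by apply: funext => i; rewrite (proj1 (svalP (eval HX t))).
apply: TRtrans (@gen_act _ (sval (eval HX t)) n _ _ s (corolla_op n) c d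
  (xop_col _) (xop_root _) e1) _.
exact: TRsym (gen_val e1 _ (xact_val s e)).
Qed.

Lemma eval_rep n (c : 'I_n -> X eta) d (t : term c d) :
  eval HX (rep (cls t)) = eval HX t.
Proof. exact: existT_inj (eval_rel HX (rep_cls t)). Qed.

Lemma unit_inj (T : tree) (x y : X T) : tau_unit_fun x = tau_unit_fun y -> x = y.
Proof.
move=> e; apply: (small_unique HX) => [a|n f].
  exact: (congr1 (fun g : operad_map (Omega T) (tau X) => mcol g a) e).
pose w := mop f (corolla_op n).
(* Evaluating the image of the operation [w] recovers the restriction along [f]. *)
pose F (g : operad_map (Omega T) (tau X)) := sval (eval HX (rep (mop g w))).
have FE z : F (tau_unit_fun z) = dres f z.
  rewrite /F /= eval_rep /=; congr dres.
  by rewrite -op_map_mop op_map_corolla operad_map_comp1r.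
by rewrite -!FE e.
Qed.

(** Every operation of [Omega eta] is an identity, so a map out of it is given by a colour. *)
Lemma eta_onto (f : operad_map (Omega eta) (tau X)) :
  exists x : X eta, tau_unit_fun x = f.
Proof.
exists (mcol f tt); have fg : mcol (tau_unit_fun (mcol f tt)) = mcol f.
  by apply: funext => -[]; apply: edge_col_eta.
apply: (agree_all fg) => n c d w.
have [_ _ /(_ _ (below_refl d))[[k _]|[[]]]] := elimT (Omega_opP _ _) w.
by apply: (@agree_id _ _ _ _ fg _ _ _ w k); case: (c k) d {w} => -[].
Qed.

Lemma corolla_onto n (f : operad_map (Omega (corolla 'I_n)) (tau X)) :
  exists x : X (corolla 'I_n), tau_unit_fun x = f.
Proof.
pose o := mop f (corolla_op n); pose y := eval HX (rep o).
exists (sval y); have fg : mcol (tau_unit_fun (sval y)) = mcol f.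
  apply: funext; apply: corolla_edge => [|i]; first exact: xop_root.
  exact: (proj1 (svalP y)).
have ag : agree (tau_unit_fun (sval y)) f (corolla_op n).
  move=> ec ed; rewrite -/o -(repK o) (cls_rel (term_gen (rep o))).
  exact: tau_cast_gen.
apply: (agree_all fg) => m c d w.
case: (pselect (exists k, c k = d)) => [[k ck]|nk]; first exact: (@agree_id _ _ _ _
    fg _ _ _ w k).
have [h1 h2 h3] := elimT (Omega_opP _ _) w.
have {}nk k : c k <> d by move=> ck; apply: nk; exists k.
have /esym ed : d = None.
  move: d {w h2} h1 h3 nk; apply: corolla_edge => // i h1 h3 nk.
  case: (h3 _ (below_refl _)) => [[k _]|[v /input_leaf//]].
  by case: (nk k); apply/esym/(above_leaf (@input_leaf _ i)).
case: d / ed w h1 h2 h3 nk => w h1 h2 h3 nk.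
(* Apart from identities, the operations of the corolla are the permutations of [corolla_op n]. *)
apply: (agree_perm fg (w := corolla_op n)) ag => [i|k].
  case: (h3 (input i) (below_root _)) => [[k]|[v /input_leaf//]].
  move: (nk k); case ck : (c k) => [[j []]|] // _ ji; exists k; rewrite ck.
  by congr (Some (Tagged _ _)); apply: (join_below_tag (T := fun _ => eta)) ji.
by case ck : (c k) (nk k) => [[i []]|] // _; exists i.
Qed.

Lemma unit_onto (T : tree) (f : operad_map (Omega T) (tau X)) :
  exists x : X T, tau_unit_fun x = f.
Proof.
have [m] := ubnP #|vert T|; elim: m => // m IH in T f *; rewrite ltnS => hT.
have retract S (k : tree_map S T) (r : tree_map T S) :
    operad_map_comp k r = operad_map_id _ ->
    (forall g : operad_map (Omega S) (tau X), exists x : X S, tau_unit_fun x = g) ->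
    exists x : X T, tau_unit_fun x = f.
  move=> kr /(_ (operad_map_comp f k))[x xE]; exists (dres r x).
  by rewrite tau_unit_nat xE -operad_map_compA kr operad_map_comp1r.
case hT1 : (1 < #|vert T|); last first.
  case hT0 : #|vert T| hT1 => [|[|k]] // _.
    by have [r /retract] := tree0_eta hT0; apply; apply: eta_onto.
  by have [n [k [r /retract]]] := tree1_corolla hT0; apply; apply: corolla_onto.
have [e0 he0] := exists_inner hT1; have [v iv top] := exists_top_edge he0.
(* Injectivity of the unit makes this relation functional, and induction supplies values over the
   pruned tree and over the corolla of [v]. *)
pose R S (p : tree_map S T) (y : X S) := tau_unit_fun y = operad_map_comp f p.
have [||S p|x xP] := @extend_off_edge X HX T (out v) R top.
- by move=> S p y y' h h'; apply: unit_inj; rewrite h h'.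
- by move=> S' S h p y hy; rewrite /R tau_unit_nat hy operad_map_compA.
- have R_comp S' (q : tree_map S' T) (g : tree_map S S') : #|vert S'| < m ->
      exists y, R S (operad_map_comp q g) y.
    move=> /(IH _ (operad_map_comp f q))[y yE]; exists (dres g y).
    by rewrite /R tau_unit_nat yE operad_map_compA.
  case/(not_interior_factor iv top) => -[g ->]; apply: R_comp.
    exact: leq_trans (face_card (FaceOuter _)) hT.
  apply: leq_trans hT; apply: leq_ltn_trans hT1.
  by rewrite card_option card_tagged sumnE big_map big1 // => i _; rewrite card_void.
have xR S (p : tree_map S T) : ~ interior p (out v) ->
    operad_map_comp (tau_unit_fun x) p = operad_map_comp f p.
  by move=> /xP; rewrite /R tau_unit_nat.
exists x; have fg : mcol (tau_unit_fun x) = mcol f.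
  apply: funext => a; have := xR _ (edge_map a) (@eta_not_interior _ _ _).
  by move/(congr1 (fun g : operad_map (Omega eta) (tau X) => mcol g tt)).
by apply: (agree_off_edge fg (e := out v)) => n p; apply: xR.
Qed.

End Unit.

Theorem theorem6p1 (X : dset) (HX : strict_inner_kan X) :
  dset_iso (tau_unit X).
Proof.
pose g (T : tree) (f : nerve (tau X) T) : {x : X T | tau_unit_fun x = f} :=
  cid (unit_onto HX f).
have gnat (S T : tree) (p : tree_map S T) (f : nerve (tau X) T) :
    (* The pointwise inverse is natural because the unit is natural and injective. *)
    sval (g S (dres p f)) = dres p (sval (g T f)).
  apply: (unit_inj HX); rewrite tau_unit_nat (svalP (g T f)).
  exact: svalP (g S (dres p f)).
exists (@DMor (nerve (tau X)) X (fun T f => sval (g T f)) gnat).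
split; apply: dmor_ext => T x /=; last exact: svalP (g T x).
by apply: (unit_inj HX); apply: svalP (g T (tau_unit_fun x)).
Qed.
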